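(* Let $\mathfrak R$ be any recursively enumerable set of nonnegative integers. Then there exist a positive integer $\varepsilon$ and polynomials $P_\iota, D_\iota, Q_\iota$ ($\iota=1,\dots,\varepsilon$) in three variables with integer coefficients such that for every nonnegative integer $a$: $$a\in\mathfrak R \iff \exists b\,\exists c \bigwedge_{\iota=1}^{\varepsilon}\exists d\,\bigl[P_\iota(a,b,c)<D_\iota(a,b,c)\,d<Q_\iota(a,b,c)\bigr],$$ where the quantified variables $b,c,d$ range over nonnegative integers. *)

(* Defs.v *)
From HB Require Import structures.
From mathcomp Require Import all_boot all_order all_algebra.
From mathcomp Require Import mpoly.

Set Implicit Arguments.
Unset Strict Implicit.
Unset Printing Implicit Defensive.

Import Order.TTheory GRing.Theory Num.Theory.

(* Kleene's schemes for partial recursive functions of n arguments. *)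
Inductive parrec : nat -> Type :=
| PZero n : parrec n
| PSucc : parrec 1
| PProj n (i : 'I_n) : parrec n
| PComp m n (g : parrec m) (h : 'I_m -> parrec n) : parrec n
| PRec n (g : parrec n) (h : parrec n.+2) : parrec n.+1
| PMu n (f : parrec n.+1) : parrec n.

(* [computes f v y]: f is defined at v, with value y.
   - For [PRec], the recursion argument comes first and s lists the successive
     values:  s 0 = g(x),  s (k+1) = h(k, s k, x).
   - For [PMu], the value at v is the least y with f(y, v) = 0, and f must be
     defined and nonzero at (z, v) for every z < y. *)
Fixpoint computes n (f : parrec n) : n.-tuple nat -> nat -> Prop :=
  match f in parrec n return n.-tuple nat -> nat -> Prop with
  | PZero _ => fun _ y => y = 0
  | PSucc => fun v y => y = (thead v).+1
  | PProj _ i => fun v y => y = tnth v i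
  | PComp m _ g h => fun v y =>
      exists w : m.-tuple nat,
        (forall i, computes (h i) v (tnth w i)) /\ computes g w y
  | PRec n g h => fun v y =>
      let x : n.-tuple nat := [tuple of behead v] in
      exists s : nat -> nat,
        [/\ computes g x (s 0),
            forall k, k < thead v ->
              computes h [tuple of k :: s k :: x] (s k.+1)
          & y = s (thead v)]
  | PMu _ f => fun v y =>
      computes f [tuple of y :: v] 0 /\
      forall z, z < y -> exists u, computes f [tuple of z :: v] u.+1
  end.

Lemma computes_inj n (f : parrec n) v y y' :
  computes f v y -> computes f v y' -> y = y'.
Proof.
elim: f v y y' => /=.
- by move=> ? _ ? ? -> ->.
- by move=> ? ? ? -> ->.
- by move=> ? ? ? ? ? -> ->.
- move=> m {}n g IHg h IHh v y y' [w [hw gw]] [w' [hw' gw']].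
  have eqw : w = w' by apply: eq_from_tnth => i; apply: IHh (hw i) (hw' i).
  by rewrite -eqw in gw'; apply: IHg gw gw'.
- move=> {}n g IHg h IHh v y y' [s [s0 sS ->]] [s' [s0' sS' ->]].
  suff: forall k, k <= thead v -> s k = s' k by apply.
  elim=> [_|k IHk ltk]; first exact: IHg s0 s0'.
  have := sS' _ ltk; rewrite -(IHk (ltnW ltk)).
  exact: IHh (sS _ ltk).
- move=> {}n f IHf v y y' [f0 fS] [f0' fS'].
  case: (ltngtP y y') => // [/fS'|/fS] [u fu].
  + by have := IHf _ _ _ f0 fu.
  + by have := IHf _ _ _ f0' fu.
Qed.

Definition recursively_enumerable (A : nat -> Prop) : Prop :=
  exists f : parrec 1, forall a, A a <-> exists y, computes f [tuple a] y.

Definition eval3 (p : {mpoly int[3]}) (a b c : nat) : int :=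
  p.@[fun i => tnth [tuple a%:Z; b%:Z; c%:Z]%R i].

(* Main.v *)
(* A recursively enumerable set is Diophantine: exponentiation is Diophantine by
   means of the Pell equation, hence so are binomial coefficients (digits of
   (1 + B)^n in base B), factorials (integer quotients r^n / C(r, n)) and, by a
   Chinese remainder coding of the witnesses, bounded universal quantifiers; this
   covers primitive recursion and minimization.
   A Diophantine condition on a amounts to a system of equations
   z_i z_j = z_k + z_l with z_0 = 1 and z_1 = a.  The solution is coded by the number
   b = sum_i z_i B^(2^i), where the base B is a large multiple of c^2 and c bounds all
   z_i.  As 2^i + 2^j determines {i, j}, the digit of b^2 at that position is z_i z_j,
   or twice it if i <> j, and only small digits occur.  Hence both the shape of b and
   each equation say that some polynomial in a, b, c is close to a multiple of a power
   of B, which is an interval condition on the quotient d. *)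

Require Import Defs.
From HB Require Import structures.
From mathcomp Require Import all_boot all_order all_algebra.
From mathcomp Require Import mpoly.
From mathcomp Require Import zify ring.
From Stdlib Require Import FunctionalExtensionality.

Set Implicit Arguments.
Unset Strict Implicit.
Unset Printing Implicit Defensive.

Import Order.TTheory GRing.Theory Num.Theory.

(** * Solutions of the Pell equation *)

Section Pell.
Local Open Scope ring_scope.
Implicit Types (a b x y : int) (k m n r : nat).

(** Each conjunct has a [d] of its own, so all that the conjuncts share must sit in [b] and [c], and
    no exponent may vary. This is possible because the number n of unknowns z_i depends on the set
    alone: every power of B that occurs has a fixed exponent and is a polynomial in [c]. The
    obstacle is that the interval conditions never bound [b] from above. They control it modulo
    B^(2^n) only, so [b] is the code plus an arbitrary multiple of B^(2^n). Hence all digits are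
    compared at the single position 2^n, modulo B^(2^n + 1). The arbitrary part does not disturb
    this position in b^2, because the exponents 2^i start at 1 and the code is a multiple of B. The
    digits below that position are not controlled individually either; together they amount to a
    small fraction of B^(2^n), which an interval tolerates and an equation would not. *)

Fixpoint pell a n : int * int :=
  if n is m.+1 then
    (a * (pell a m).1 + (a * a - 1) * (pell a m).2, (pell a m).1 + a * (pell a m).2)
  else (1, 0).
(** With s = sqrt(a^2 - 1), the power (a + s)^n is [px a n] + s [py a n]; most identities below are
    read off from such powers. *)
Definition px a n := (pell a n).1.
Definition py a n := (pell a n).2.

Lemma pxS a n : px a n.+1 = a * px a n + (a * a - 1) * py a n.
Proof. by []. Qed.

Lemma pyS a n : py a n.+1 = px a n + a * py a n.
Proof. by []. Qed.

Lemma pell_eq a n : px a n * px a n = (a * a - 1) * (py a n * py a n) + 1.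
Proof.
elim: n => [|n IHn]; first by rewrite /px /py /=; ring.
by rewrite pxS pyS; lia.
Qed.

Lemma pellD a m n :
  px a (m + n) = px a m * px a n + (a * a - 1) * py a m * py a n /\
  py a (m + n) = px a m * py a n + py a m * px a n.
Proof.
elim: m => [|m [IHx IHy]]; first by rewrite /px /py /=; split; ring.
by rewrite addSn !pxS !pyS IHx IHy; split; ring.
Qed.

Lemma pell_gt0 a n : 1 <= a -> 0 < px a n /\ 0 <= py a n.
Proof.
move=> a1; elim: n => [|n [IHx IHy]] //; rewrite pxS pyS.
have d0 : 0 <= a * a - 1 by nia.
have := mulr_ge0 d0 IHy.
by split; nia.
Qed.

Lemma py_lt a n : 1 <= a -> py a n < py a n.+1.
Proof. by move=> a1; have [] := pell_gt0 n a1; rewrite pyS; nia. Qed.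

Lemma py_mono a m n : 1 <= a -> (m <= n)%N -> py a m <= py a n.
Proof.
move=> a1 /subnKC <-; elim: (n - m)%N => [|k IHk]; first by rewrite addn0.
by rewrite addnS; apply: le_trans IHk (ltW (py_lt _ _)).
Qed.

Lemma py_ge a n : 1 <= a -> n%:Z <= py a n.
Proof.
by move=> a1; elim: n => [|n IHn] //; have := py_lt n a1; lia.
Qed.

(** Makes the residues y_r and -y_r with r <= m distinct modulo x_m, apart from y_0 = 0. For a = 2
    the bound fails at n = 1. *)
Lemma px_gt a n : 3 <= a -> 2 * py a n < px a n.
Proof.
move=> a3; have [|x0 y0] := @pell_gt0 a n; first by lia.
rewrite ltNge; apply/negP => h.
have h1 : 0 <= (a * a - 9) * (py a n * py a n) by apply: mulr_ge0; nia.
have h2 : px a n * px a n <= 2 * py a n * (2 * py a n) by apply: ler_pM => //; lia.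
by have := pell_eq a n; nia.
Qed.

(** Descent: multiplying x + y sqrt(a^2 - 1) by a - sqrt(a^2 - 1) gives a solution with smaller
    y. *)
Lemma pell_complete a x y : 1 <= a -> 0 <= x -> 0 <= y ->
  x * x = (a * a - 1) * (y * y) + 1 -> exists n, x = px a n /\ y = py a n.
Proof.
move=> a1; have [n] := ubnP `|y|%N; elim: n x y => // n IHn x y lty x0 y0 h.
have [y0'|y1] := leP y 0.
  have ey : y = 0 by lia.
  by exists 0%N; split; rewrite // /px /=; move: h; rewrite ey; nia.
have h1 : x <= a * y by nia.
have h2 : (a - 1) * y < x by nia.
have h3 : (a * a - 1) * y <= a * x by nia.
have [||||m [hx hy]] := IHn (a * x - (a * a - 1) * y) (a * y - x).
- by nia.
- by lia.
- by lia.
- by lia.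
by exists m.+1; rewrite pxS pyS -hx -hy; split; ring.
Qed.

Lemma pell_modl (M : int) a b n : (M %| a - b)%Z ->
  (M %| px a n - px b n)%Z /\ (M %| py a n - py b n)%Z.
Proof.
case/dvdzP=> q h; have {h}-> : a = q * M + b by rewrite -h; ring.
elim: n => [|n [/dvdzP[s hs] /dvdzP[t ht]]]; first by rewrite /px /py !subrr !dvdz0.
have {}hs : px (q * M + b) n = s * M + px b n by rewrite -hs; ring.
have {}ht : py (q * M + b) n = t * M + py b n by rewrite -ht; ring.
rewrite !pxS !pyS hs ht; split; apply/dvdzP.
  exists (q * (s * M + px b n) + b * s + (b * b - 1) * t
    + (q * M * q + q * b + b * q) * (t * M + py b n)); ring.
exists (s + q * (t * M + py b n) + b * t); ring.
Qed.

(** Comparison with the degenerate parameter 1, for which y_n = n. *)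
Lemma py_mod_index a n : (a - 1 %| py a n - n%:Z)%Z.
Proof.
have h : (a - 1 %| a - 1)%Z by [].
have [_] := pell_modl n h.
have -> : py 1 n = n%:Z; last by [].
have /(_ n)[_ ->] // : forall n, px 1 n = 1 /\ py 1 n = n%:Z.
by elim=> [|m [IHx IHy]] //; rewrite pxS pyS IHx IHy; split; [ring | lia].
Qed.

Lemma pyB a m n : (n <= m)%N -> py a (m - n) = py a m * px a n - px a m * py a n.
Proof.
move=> /subnK h; have [hx hy] := pellD a (m - n) n.
rewrite h in hx hy; rewrite hx hy.
by have := congr1 (fun t => py a (m - n) * t) (pell_eq a n); lia.
Qed.

Lemma pell_double a m :
  px a (2 * m) = 2 * px a m * px a m - 1 /\ py a (2 * m) = 2 * px a m * py a m.
Proof.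
rewrite mul2n -addnn; have [-> ->] := pellD a m m.
by split; have := pell_eq a m; lia.
Qed.

(** Modulo x_m one has x_(2m) = -1 and y_(2m) = 0. So lowering the index by 2m changes the sign of
    y, while replacing n by 2m - n changes nothing. *)
Lemma py_reduce a m n : (0 < m)%N -> exists r j : nat, (r <= m)%N /\
  ((n = j * (2 * m) + r)%N \/ (n + r = j * (2 * m))%N) /\
  ((px a m %| py a n - py a r)%Z \/ (px a m %| py a n + py a r)%Z).
Proof.
move=> m0; have [k] := ubnP n; elim: k n => // k IHk n ltn.
have [hx hy] := pell_double a m.
have [le_nm|lt_mn] := leqP n m.
  by exists n, 0%N; split=> //; split; left; rewrite ?subrr ?dvdz0.
have [le_n2m|lt_2mn] := leqP n (2 * m).
  exists (2 * m - n)%N, 1%N; split; first by lia.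
  split; first by right; lia.
  left; rewrite pyB // hx hy; apply/dvdzP.
  by exists (2 * (px a m * py a n - py a m * px a n)); ring.
have [|r [j [le_rm [hj hr]]]] := IHk (n - 2 * m)%N; first by lia.
exists r, j.+1; split=> //; split; first by case: hj => ?; [left|right]; lia.
have [_] := pellD a (2 * m) (n - 2 * m).
rewrite subnKC; last exact: ltnW.
move=> ->; rewrite hx hy.
case: hr => /dvdzP[q hq]; [right|left]; apply/dvdzP.
  exists (2 * px a m * py a (n - 2 * m) + 2 * py a m * px a (n - 2 * m) - q); lia.
exists (2 * px a m * py a (n - 2 * m) + 2 * py a m * px a (n - 2 * m) - q); lia.
Qed.

Lemma py_eq_mod a m n p : 3 <= a -> (0 < m)%N -> (p <= m)%N ->
  (px a m %| py a n - py a p)%Z ->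
  exists j : nat, (n = j * (2 * m) + p)%N \/ (n + p = j * (2 * m))%N.
Proof.
move=> a3 m0 le_pm hnp; have a1 : 1 <= a by lia.
have [r [j [le_rm [hj hr]]]] := py_reduce a n m0; exists j.
suff -> : p = r by [].
have inj i l : py a i = py a l -> i = l.
  move=> e; case: (ltngtP i l) => // h.
    by have := py_mono a1 h; have := py_lt i a1; lia.
  by have := py_mono a1 h; have := py_lt l a1; lia.
have := px_gt m a3; have := py_mono a1 le_rm; have := py_mono a1 le_pm.
have := py_ge r a1; have := py_ge p a1 => p0 r0 hp hr' hx.
apply: inj; case: hr => h.
  have {h hnp}/dvdzP[q h] : (px a m %| py a p - py a r)%Z.
    rewrite (_ : _ - _ = (py a n - py a r) - (py a n - py a p)); last by ring.
    exact: rpredB.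
  have : q = 0 by nia.
  by lia.
have {h hnp}/dvdzP[q h] : (px a m %| py a p + py a r)%Z.
  rewrite (_ : _ + _ = (py a n + py a r) - (py a n - py a p)); last by ring.
  exact: rpredB.
have : q = 0 by nia.
by lia.
Qed.

Lemma coprime_pell a n : coprimez (px a n) (py a n).
Proof.
apply/coprimezP; exists (px a n, - ((a * a - 1) * py a n)) => /=.
by have := pell_eq a n; lia.
Qed.

(** Binomial expansion of (x_k + y_k sqrt(a^2 - 1))^(q + 1): from degree two in y_k on, all terms
    are multiples of y_k^2. *)
Lemma pell_mul a k q : exists s t : int,
  px a (k * q.+1) = px a k ^+ q.+1 + s * (py a k * py a k) /\
  py a (k * q.+1) = q.+1%:Z * px a k ^+ q * py a k + t * (py a k * py a k).
Proof.
elim: q => [|q [s [t [IHx IHy]]]].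
  by exists 0, 0; rewrite muln1 expr0 expr1; split; ring.
rewrite mulnS addnC; have [-> ->] := pellD a (k * q.+1) k.
rewrite IHx IHy.
exists (s * px a k + (a * a - 1) * (q.+1%:Z * px a k ^+ q + t * py a k)).
exists (s * py a k + t * px a k).
by rewrite !exprS -[q.+2]addn1 PoszD; split; ring.
Qed.

(** For m = kq + r, y_m is x_(kq) y_r modulo y_k. The first factor is coprime to y_k, and y_r < y_k,
    so y_r = 0. *)
Lemma py_dvd a k m : 1 <= a -> (0 < k)%N -> (py a k %| py a m)%Z -> (k %| m)%N.
Proof.
move=> a1 k0; rewrite {1}(divn_eq m k) [X in (X + _)%N]mulnC.
have [_ ->] := pellD a (k * (m %/ k)) (m %% k).
have /dvdzP[t ht] : (py a k %| py a (k * (m %/ k)))%Z.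
  case: (m %/ k)%N => [|q]; first by rewrite muln0 dvdz0.
  have [s [t [_ ->]]] := pell_mul a k q.
  by apply/dvdzP; exists (q.+1%:Z * px a k ^+ q + t * py a k); ring.
have := coprime_pell a (k * (m %/ k)); rewrite ht => cop.
have {}cop : coprimez (py a k) (px a (k * (m %/ k))).
  by move: cop; rewrite coprimezMr => /andP[_]; rewrite coprimez_sym.
rewrite rpredDr; last by rewrite dvdz_mulr ?dvdz_mull.
rewrite Gauss_dvdzr // => /dvdzP[q hq].
have lt_r := ltn_pmod m k0.
have hlt := py_mono a1 lt_r; have := py_lt (m %% k) a1.
have := py_ge (m %% k) a1 => h1 h2.
have q0 : q = 0 by nia.
by rewrite /dvdn; apply/eqP; move: hq; rewrite q0; lia.
Qed.

(** For m = k(q + 1), y_k^2 must divide the linear term (q + 1) x_k^q y_k of [pell_mul]; as x_k is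
    coprime to y_k, y_k divides q + 1. *)
Lemma py_sq_dvd a k m : 1 <= a -> (0 < k)%N -> (0 < m)%N ->
  (py a k * py a k %| py a m)%Z -> (py a k %| m%:Z)%Z.
Proof.
move=> a1 k0 m0 h.
have /dvdnP[q e] : (k %| m)%N.
  by apply: (@py_dvd a) => //; apply: dvdz_trans h; apply: dvdz_mulr.
case: q e => [|q] e; first by lia.
have [s [t [_ hy]]] := pell_mul a k q.
move: h; rewrite e [X in py a X]mulnC hy rpredDr; last exact: dvdz_mull.
have y0 : py a k != 0 by have := py_ge k a1; lia.
rewrite dvdz_mul2r // Gauss_dvdzl ?PoszM.
  by move=> ?; apply: dvdz_mulr.
by rewrite coprimez_sym; apply: coprimezXl; exact: coprime_pell.
Qed.

Lemma py_sq_mul a k : (py a k * py a k %| py a (k * `|py a k|))%Z.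
Proof.
have [->|] := posnP `|py a k|%N; first by rewrite muln0 dvdz0.
case E: `|py a k|%N => [|q] // _.
have [s [t [_ ->]]] := pell_mul a k q.
rewrite rpredDr; last exact: dvdz_mull.
rewrite -mulrA mulrCA -E.
by apply: dvdz_mull; apply: dvdz_mul => //; rewrite dvdzE.
Qed.

(** Modulo 2ab - b^2 - 1 the number b - a is a square root of a^2 - 1. Substituting it in (a +
    sqrt(a^2 - 1))^n turns the left side into b^n. *)
Lemma pell_exp_mod a b n :
  (2 * a * b - (b * b + 1) %| px a n + py a n * b - (b ^+ n + py a n * a))%Z.
Proof.
elim: n => [|n /dvdzP[q hq]]; first by rewrite /px /py /= expr0 !mul0r subrr.
apply/dvdzP; exists (b * q + py a n); rewrite pxS pyS exprS.
by have := congr1 (fun t => b * t) hq; lia.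
Qed.

End Pell.

(** * Diophantine predicates *)

Inductive term : Type :=
| Par of nat
| Unk of nat
| Zer
| One
| Add of term & term
| Mul of term & term.

Fixpoint ev (e f : nat -> nat) (t : term) : nat :=
  match t with
  | Par i => e i
  | Unk i => f i
  | Zer => 0
  | One => 1
  | Add s t => ev e f s + ev e f t
  | Mul s t => ev e f s * ev e f t
  end.

Fixpoint tsub (g h : nat -> term) (t : term) : term :=
  match t with
  | Par i => g i
  | Unk i => h i
  | Zer => Zer
  | One => One
  | Add s t => Add (tsub g h s) (tsub g h t)
  | Mul s t => Mul (tsub g h s) (tsub g h t)
  end.

Fixpoint tbound (t : term) : nat :=
  match t with
  | Par i | Unk i => i.+1
  | Zer | One => 0
  | Add s t | Mul s t => maxn (tbound s) (tbound t)
  end.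

Lemma ev_tsub e f g h t :
  ev e f (tsub g h t) = ev (fun i => ev e f (g i)) (fun i => ev e f (h i)) t.
Proof. by elim: t => //= s -> t ->. Qed.

Lemma ev_eq e f e' f' t :
  (forall i, i < tbound t -> e i = e' i) ->
  (forall i, i < tbound t -> f i = f' i) -> ev e f t = ev e' f' t.
Proof.
elim: t => //= [i he _|i _ hf|s IHs t IHt he hf|s IHs t IHt he hf].
- exact: he.
- exact: hf.
- by rewrite (IHs _ _) ?(IHt _ _) // => i lti; (apply: he || apply: hf);
    rewrite leq_max lti ?orbT.
- by rewrite (IHs _ _) ?(IHt _ _) // => i lti; (apply: he || apply: hf);
    rewrite leq_max lti ?orbT.
Qed.

Lemma ev_mono e f e' f' t :
  (forall i, e i <= e' i) -> (forall i, i < tbound t -> f i <= f' i) ->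
  ev e f t <= ev e' f' t.
Proof.
move=> he; elim: t => //= [i hf|s IHs t IHt hf|s IHs t IHt hf].
- exact: hf.
- by apply: leq_add; [apply: IHs | apply: IHt] => i lti; apply: hf;
    rewrite leq_max lti ?orbT.
- by apply: leq_mul; [apply: IHs | apply: IHt] => i lti; apply: hf;
    rewrite leq_max lti ?orbT.
Qed.

Lemma ev_mod m e f e' f' t :
  (forall i, e i = e' i %[mod m]) ->
  (forall i, i < tbound t -> f i = f' i %[mod m]) ->
  ev e f t = ev e' f' t %[mod m].
Proof.
move=> he; elim: t => //= [i hf|s IHs t IHt hf|s IHs t IHt hf].
- exact: hf.
- rewrite -modnDm IHs ?IHt ?modnDm // => i lti; apply: hf;
    by rewrite leq_max lti ?orbT.
- rewrite -modnMm IHs ?IHt ?modnMm // => i lti; apply: hf;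
    by rewrite leq_max lti ?orbT.
Qed.

(* The parameters of [S] are [e], the unknowns are [f]. *)
Definition dio (S : (nat -> nat) -> Prop) : Prop :=
  exists p q, forall e, S e <-> exists f, ev e f p = ev e f q.

Definition scons (x : nat) (e : nat -> nat) (i : nat) : nat :=
  if i is j.+1 then e j else x.

Definition interleave (f e : nat -> nat) (i : nat) : nat :=
  if odd i then e i./2 else f i./2.

Lemma interleave_even f e i : interleave f e i.*2 = f i.
Proof. by rewrite /interleave odd_double doubleK. Qed.

Lemma interleave_odd f e i : interleave f e i.*2.+1 = e i.
Proof. by rewrite /interleave /= odd_double /= uphalf_double. Qed.

Lemma dio_ext S S' : dio S -> (forall e, S e <-> S' e) -> dio S'.
Proof.
by case=> p [q h] hS; exists p, q => e; rewrite -hS; exact: h.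
Qed.

(** Terms mention finitely many variables. This reduces a substitution for all parameters to a
    finite conjunction and allows exchanging environments that agree far enough. *)
Lemma dio_finite S : dio S -> exists m, forall e e',
  (forall i, i < m -> e i = e' i) -> S e -> S e'.
Proof.
case=> p [q h]; exists (maxn (tbound p) (tbound q)) => e e' ee' /h [f hf].
apply/h; exists f.
by rewrite -(ev_eq (e := e) (f := f)) // -?(ev_eq (t := q) (e := e) (f := f)) //
  => i lti; apply: ee'; rewrite leq_max lti ?orbT.
Qed.

Lemma dio_eqt p q : dio (fun e => ev e e p = ev e e q).
Proof.
exists (tsub Par Par p), (tsub Par Par q) => e.
by split=> [|[f]]; [exists e|]; rewrite !ev_tsub.
Qed.

(** The hypothesis is (a - b)^2 + (c - d)^2 = 0 with the negative terms moved across. *)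
Lemma sum_sq_eq a b c d :
  a * a + b * b + (c * c + d * d) = a * b + a * b + (c * d + c * d) ->
  a = b /\ c = d.
Proof.
have [h1 e1] := nat_Cauchy a b; have [h2 e2] := nat_Cauchy c d.
move: h1 h2 e1 e2; rewrite !mul2n -!addnn -!mulnn => h1 h2 e1 e2 h.
by split; apply/eqP; rewrite -?e1 -?e2; apply/eqP; lia.
Qed.

Lemma dio_and S T : dio S -> dio T -> dio (fun e => S e /\ T e).
Proof.
case=> p [q hS] [p' [q' hT]].
pose l := tsub Par (fun i => Unk i.*2); pose r := tsub Par (fun i => Unk i.*2.+1).
pose sq t := Mul t t; pose db t := Add t t.
exists (Add (Add (sq (l p)) (sq (l q))) (Add (sq (r p')) (sq (r q')))).
exists (Add (db (Mul (l p) (l q))) (db (Mul (r p') (r q')))).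
move=> e; rewrite hS hT; split.
  case=> -[f hf] [g hg]; exists (interleave f g).
  rewrite /= !ev_tsub /=.
  have E1 t : ev e (fun i => interleave f g i.*2) t = ev e f t.
    by apply: ev_eq => // i _; rewrite interleave_even.
  have E2 t : ev e (fun i => interleave f g i.*2.+1) t = ev e g t.
    by apply: ev_eq => // i _; rewrite interleave_odd.
  by rewrite !E1 !E2 hf hg.
case=> f /=; rewrite !ev_tsub /= => h.
have [h1 h2] := sum_sq_eq h.
by split; [exists (fun i => f i.*2) | exists (fun i => f i.*2.+1)].
Qed.

(** The equation (p - q)(p' - q') = 0, again without subtraction; the unknowns may be shared, since
    one factor suffices. *)
Lemma dio_or S T : dio S -> dio T -> dio (fun e => S e \/ T e).
Proof.
case=> p [q hS] [p' [q' hT]].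
exists (Add (Mul p p') (Mul q q')), (Add (Mul p q') (Mul q p')) => e.
rewrite hS hT; split.
  by case=> -[f hf]; exists f => /=; rewrite hf; lia.
case=> f /= h; have [hp|hp] := eqVneq (ev e f p) (ev e f q).
  by left; exists f.
by right; exists f; nia.
Qed.

Lemma dio_exf S : dio S -> dio (fun e => exists f, S (interleave f e)).
Proof.
case=> p [q hS].
pose l := tsub (fun i => if odd i then Par i./2 else Unk i./2.*2)
               (fun i => Unk i.*2.+1).
exists (l p), (l q) => e; split.
  case=> f /hS [g h]; exists (interleave f g); rewrite !ev_tsub /=.
  have E t : ev (fun i => ev e (interleave f g) (if odd i then Par i./2 else Unk i./2.*2))
      (fun i => interleave f g i.*2.+1) t = ev (interleave f e) g t.
    apply: ev_eq => i _; last by rewrite interleave_odd.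
    by rewrite {2}/interleave; case: (odd i) => //=; rewrite interleave_even.
  by rewrite !E.
case=> g; rewrite !ev_tsub /= => h; exists (fun i => g i.*2); apply/hS.
exists (fun i => g i.*2.+1).
have E t : ev (fun i => ev e g (if odd i then Par i./2 else Unk i./2.*2))
    (fun i => g i.*2.+1) t =
    ev (interleave (fun i => g i.*2) e) (fun i => g i.*2.+1) t.
  by apply: ev_eq => i _ //; rewrite /interleave; case: (odd i).
by rewrite -!E.
Qed.

Lemma dio_rename (r : nat -> nat) S : dio S -> dio (fun e => S (fun i => e (r i))).
Proof.
case=> p [q hS]; exists (tsub (fun i => Par (r i)) Unk p), (tsub (fun i => Par (r i)) Unk q).
by move=> e; rewrite hS; split=> -[f h]; exists f; move: h; rewrite !ev_tsub.
Qed.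

Lemma dio_scons S : dio S -> dio (fun e => exists x, S (scons x e)).
Proof.
move=> hS; have [m Sm] := dio_finite hS.
apply: dio_ext (dio_exf (dio_rename (fun i => if i is j.+1 then j.*2.+1 else 0) hS)) _.
move=> e; split.
  case=> f h; exists (f 0); apply: Sm h => -[|i] _ //=; exact: interleave_odd.
case=> x h; exists (fun=> x); apply: Sm h => -[|i] _ //=; by rewrite interleave_odd.
Qed.

Lemma dio_ex (R : nat -> (nat -> nat) -> Prop) :
  dio (fun e => R (e 0) (fun i => e i.+1)) -> dio (fun e => exists x, R x e).
Proof. exact: dio_scons. Qed.

Lemma dio_all (m : nat) (S : nat -> (nat -> nat) -> Prop) :
  (forall i, i < m -> dio (S i)) -> dio (fun e => forall i, i < m -> S i e).
Proof.
elim: m => [|m IHm] hS.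
  by apply: dio_ext (dio_eqt One One) _.
apply: dio_ext (dio_and (IHm _) (hS m _)) _ => // [i /ltnW|e]; first exact: hS.
split=> [[h hm] i|h]; last by split=> [i /ltnW|]; apply: h.
by rewrite ltnS leq_eqVlt => /predU1P[->|/h].
Qed.

Definition dfun (F : (nat -> nat) -> nat) : Prop :=
  dio (fun e => e 0 = F (fun i => e i.+1)).

(** The substituted values become new unknowns. Only the finitely many that [S] reads are tied to
    their functions. *)
Lemma dio_sub (s : nat -> (nat -> nat) -> nat) S :
  dio S -> (forall i, dfun (s i)) -> dio (fun e => S (fun i => s i e)).
Proof.
move=> hS hs; have [m Sm] := dio_finite hS.
pose T (g : nat -> nat) := S (fun i => g i.*2) /\
  forall i, i < m -> g i.*2 = s i (fun j => g j.*2.+1).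
have dT : dio T.
  apply: dio_and; first exact: dio_rename hS.
  apply: dio_all => i _.
  exact: (dio_rename (fun j => if j is k.+1 then k.*2.+1 else i.*2) (hs i)).
have se i g e : s i (fun j => interleave g e j.*2.+1) = s i e.
  have [n Sn] := dio_finite (hs i).
  apply: (Sn (scons (s i (fun j => interleave g e j.*2.+1)) (fun j => interleave g e j.*2.+1))
    (scons _ e)) => //.
  by case=> [|j] //= _; rewrite interleave_odd.
apply: dio_ext (dio_exf dT) _ => e; split.
  case=> g [h1 h2]; apply: Sm h1 => i lti.
  by rewrite h2 // se.
move=> h; exists (fun i => s i e); split.
  by apply: Sm h => i _; rewrite interleave_even.
by move=> i _; rewrite interleave_even se.
Qed.

Lemma dfun_proj i : dfun (fun e => e i).
Proof. exact: (dio_eqt (Par 0) (Par i.+1)). Qed.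

Lemma dfun_shift F : dfun F -> dfun (fun e => F (fun i => e i.+1)).
Proof. exact: (dio_rename (fun i => if i is j.+1 then j.+2 else 0)). Qed.

Lemma dfun_sub (s : nat -> (nat -> nat) -> nat) F :
  dfun F -> (forall i, dfun (s i)) -> dfun (fun e => F (fun i => s i e)).
Proof.
move=> hF hs.
apply: (dio_sub (s := fun i e => if i is j.+1 then s j (fun k => e k.+1) else e 0) hF).
by case=> [|i]; [exact: dfun_proj | exact: dfun_shift].
Qed.

Lemma dfun_ext F G : dfun F -> (forall e, F e = G e) -> dfun G.
Proof. by move=> hF FG; apply: dio_ext hF _ => e; rewrite FG. Qed.


Lemma dio_sub2 (R : nat -> nat -> Prop) F G :
  dio (fun e => R (e 0) (e 1)) -> dfun F -> dfun G -> dio (fun e => R (F e) (G e)).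
Proof.
move=> hR hF hG.
by apply: (dio_sub (s := fun i => if i is 0 then F else G) hR) => -[].
Qed.

Lemma dio_sub3 (R : nat -> nat -> nat -> Prop) F G H :
  dio (fun e => R (e 0) (e 1) (e 2)) -> dfun F -> dfun G -> dfun H ->
  dio (fun e => R (F e) (G e) (H e)).
Proof.
move=> hR hF hG hH.
by apply: (dio_sub (s := fun i => match i with 0 => F | 1 => G | _ => H end) hR)
  => -[|[]].
Qed.

Lemma dfun1 (f : nat -> nat) F :
  dfun (fun e => f (e 0)) -> dfun F -> dfun (fun e => f (F e)).
Proof. by move=> hf hF; apply: (dfun_sub (s := fun _ => F) hf). Qed.

Lemma dfun2 (f : nat -> nat -> nat) F G :
  dfun (fun e => f (e 0) (e 1)) -> dfun F -> dfun G -> dfun (fun e => f (F e) (G e)).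
Proof.
move=> hf hF hG.
by apply: (dfun_sub (s := fun i => if i is 0 then F else G) hf) => -[].
Qed.

Lemma dfun_const n : dfun (fun=> n).
Proof.
by elim: n => [|n IHn]; [exact: (dio_eqt (Par 0) Zer) |
  apply: (dio_ext (dio_sub2 (R := fun x y => x = y + 1)
    (dio_eqt (Par 0) (Add (Par 1) One)) (dfun_proj 0) (dfun_shift IHn))) => e;
  rewrite addn1].
Qed.

Lemma dfun_add F G : dfun F -> dfun G -> dfun (fun e => F e + G e).
Proof. exact: (dfun2 (f := addn) (dio_eqt (Par 0) (Add (Par 1) (Par 2)))). Qed.

Lemma dfun_mul F G : dfun F -> dfun G -> dfun (fun e => F e * G e).
Proof. exact: (dfun2 (f := muln) (dio_eqt (Par 0) (Mul (Par 1) (Par 2)))). Qed.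

Lemma dfun_succ F : dfun F -> dfun (fun e => (F e).+1).
Proof.
move=> hF; apply: dfun_ext (dfun_add hF (dfun_const 1)) _ => e; exact: addn1.
Qed.

Lemma dio_eq F G : dfun F -> dfun G -> dio (fun e => F e = G e).
Proof. exact: (dio_sub2 (R := @eq nat) (dio_eqt (Par 0) (Par 1))). Qed.

Lemma dio_and3 A B C : dio A -> dio B -> dio C ->
  dio (fun e => [/\ A e, B e & C e]).
Proof.
move=> hA hB hC; apply: dio_ext (dio_and hA (dio_and hB hC)) _ => e.
by split=> [[? []]|[]].
Qed.

Lemma dio_and4 A B C D : dio A -> dio B -> dio C -> dio D ->
  dio (fun e => [/\ A e, B e, C e & D e]).
Proof.
move=> hA hB hC hD; apply: dio_ext (dio_and hA (dio_and3 hB hC hD)) _ => e.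
by split=> [[? []]|[]].
Qed.

Lemma dio_and5 A B C D E : dio A -> dio B -> dio C -> dio D -> dio E ->
  dio (fun e => [/\ A e, B e, C e, D e & E e]).
Proof.
move=> hA hB hC hD hE; apply: dio_ext (dio_and hA (dio_and4 hB hC hD hE)) _ => e.
by split=> [[? []]|[]].
Qed.

(** A hook, redefined whenever a further function or relation is known to be Diophantine. *)
Ltac dio_fun := fail.

Ltac dio_step :=
  match goal with
  | |- forall _, _ => intro
  | |- _ => dio_fun
  | |- dio _ => first [apply: dio_and | apply: dio_and3 | apply: dio_and4
     | apply: dio_and5 | apply: dio_or | apply: dio_ex | apply: dio_eq]
  | |- dfun _ => first [apply: dfun_proj | apply: dfun_const | apply: dfun_add
     | apply: dfun_mul | apply: dfun_succ]
  end.

Ltac dio := repeat (cbv beta; dio_step).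

Lemma dio_leq F G : dfun F -> dfun G -> dio (fun e => F e <= G e).
Proof.
apply: (dio_sub2 (R := fun x y => x <= y)).
apply: dio_ext (_ : dio (fun e => exists d, e 1 = e 0 + d)) _; first by dio.
by move=> e; split=> [[d ->]|h]; [exact: leq_addr | exists (e 1 - e 0); rewrite subnKC].
Qed.

Ltac dio_fun ::= apply: dio_leq.

Lemma dfun_subn F G : dfun F -> dfun G -> dfun (fun e => F e - G e).
Proof.
apply: (dfun2 (f := subn)).
apply: dio_ext (_ : dio (fun e => e 1 = e 2 + e 0 \/ e 1 <= e 2 /\ e 0 = 0)) _.
  by dio.
by move=> e; lia.
Qed.

Ltac dio_fun ::= first [apply: dio_leq | apply: dfun_subn].

Lemma dfun_divn F G : dfun F -> dfun G -> dfun (fun e => F e %/ G e).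
Proof.
apply: (dfun2 (f := divn)).
(* The first disjunct follows the convention [x %/ 0 = 0]. *)
apply: dio_ext (_ : dio (fun e => e 2 = 0 /\ e 0 = 0 \/
   exists r, r < e 2 /\ e 1 = e 0 * e 2 + r)) _; first by dio.
move=> e; split=> [[[-> ->]|[r [ltr ->]]]|->]; first by rewrite divn0.
  by rewrite divnMDl ?divn_small ?addn0 //; apply: leq_ltn_trans ltr.
have [->|e2] := posnP (e 2); first by left; rewrite divn0.
by right; exists (e 1 %% e 2); rewrite ltn_mod -divn_eq.
Qed.

Lemma dfun_modn F G : dfun F -> dfun G -> dfun (fun e => F e %% G e).
Proof.
move=> hF hG.
apply: dfun_ext (dfun_subn hF (dfun_mul (dfun_divn hF hG) hG)) _ => e.
by rewrite {1}(divn_eq (F e) (G e)) addKn.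
Qed.

Lemma dio_dvdn F G : dfun F -> dfun G -> dio (fun e => F e %| G e).
Proof.
move=> hF hG; apply: dio_ext (dio_eq (dfun_modn hG hF) (dfun_const 0)) _ => e.
by split=> /eqP.
Qed.

Ltac dio_fun ::= first [apply: dio_leq | apply: dfun_subn | apply: dfun_divn
  | apply: dfun_modn | apply: dio_dvdn].

(** * The sequence of Pell solutions is Diophantine *)

Definition xn (a n : nat) : nat := `|px a n|%N.
Definition yn (a n : nat) : nat := `|py a n|%N.

Definition is_pell (a x y : nat) := x * x = (a * a - 1) * (y * y) + 1.

Lemma xnE a n : 0 < a -> Posz (xn a n) = px a n.
Proof. by move=> a0; have [|+ _] := @pell_gt0 a n; [lia | rewrite /xn; lia]. Qed.

Lemma ynE a n : 0 < a -> Posz (yn a n) = py a n.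
Proof. by move=> a0; have [|_ +] := @pell_gt0 a n; [lia | rewrite /yn; lia]. Qed.

Lemma is_pellP a x y : 0 < a ->
  is_pell a x y <-> exists n, x = xn a n /\ y = yn a n.
Proof.
move=> a0; split=> [h|[n [-> ->]]].
  have [||||n [hx hy]] := @pell_complete a x y; rewrite ?lez_nat //.
    by move: h; rewrite /is_pell; nia.
  by exists n; rewrite /xn /yn -hx -hy.
have := pell_eq a n; rewrite /is_pell -xnE // -ynE //; nia.
Qed.

Lemma dvdz_eqmod (m u v : nat) : (Posz m %| (Posz u - Posz v)%R)%Z <-> u = v %[mod m].
Proof.
by rewrite -eqz_mod_dvd !modz_nat eqz_nat; split=> /eqP.
Qed.

Lemma yn_ge a n : 0 < a -> n <= yn a n.
Proof. by move=> a0; rewrite -lez_nat ynE //; apply: py_ge. Qed.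

Lemma xn_gt0 a n : 0 < a -> 0 < xn a n.
Proof.
by move=> a0; rewrite -ltz_nat xnE //; have [|] := @pell_gt0 a n; first by lia.
Qed.

Lemma pell_congr a b M n : 0 < a -> 0 < b -> a = b %[mod M] ->
  yn a n = yn b n %[mod M].
Proof.
move=> a0 b0 /dvdz_eqmod h; apply/dvdz_eqmod; rewrite !ynE //.
by have [] := pell_modl n h.
Qed.

Lemma yn_congr_index a u n : 0 < a -> a = 1 %[mod u] -> yn a n = n %[mod u].
Proof.
move=> a0 /dvdz_eqmod h; apply/dvdz_eqmod; rewrite ynE //.
exact: dvdz_trans h (py_mod_index a n).
Qed.

Lemma xn_yn_coprime a n : 0 < a -> coprime (xn a n) (yn a n).
Proof. by move=> a0; have := coprime_pell a n. Qed.

(* The auxiliary solution x = y_n(w) of the Pell equation for w carries two congruences: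
   modulo s' = x_m(a) it agrees with y_n(a), which determines the index up to sign
   modulo 2m, and modulo u, which divides both w - 1 and m, it agrees with n. *)
Lemma yn_char a y c : 3 <= a ->
  y = yn a c <-> exists y' u' u s' s w x' x t,
   [/\ is_pell a y' y, is_pell a u' u, is_pell a s' s & is_pell w x' x] /\
   [/\ 2 <= w, w = a %[mod s'], w = 1 %[mod u], x = y %[mod s'] & x = c %[mod u]] /\
   [/\ 2 * y < u, 2 * c < u, 0 < s & s = t * (u * u)].
Proof.
move=> a3; have a0 : 0 < a by lia.
have a3' : (3 <= a%:Z)%R by lia.
have a1' : (1 <= a%:Z)%R by lia.
split.
  (* Since y_k >= k, this k makes u exceed 2y and 2c; the index m = ku then gives u^2 | y_m by
     [py_sq_mul]. *)
  move=> ey; pose k := 2 * y + 2 * c + 1.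
  pose u := yn a k; pose m := k * u; pose s := yn a m; pose s' := xn a m.
  have u_ge : k <= u by apply: yn_ge.
  have us : u * u %| s.
    have := py_sq_mul a k; rewrite dvdzE abszM; exact.
  have cop : coprime s' u.
    have := xn_yn_coprime m a0; rewrite -/s -/s' => h.
    by apply: coprime_dvdr h; apply: dvdn_trans us; apply: dvdn_mulr.
  (* The added multiple of both moduli only ensures w >= 2. *)
  pose w := chinese s' u a 1 + 2 * (s' * u).
  have s'0 : 0 < s' by apply: xn_gt0.
  have u0 : 0 < u by lia.
  have hw1 : w = a %[mod s'].
    by rewrite /w mulnCA -modnDmr modnMr addn0 chinese_modl.
  have hw2 : w = 1 %[mod u].
    by rewrite /w mulnA -modnDmr modnMl addn0 chinese_modr.
  have w2 : 2 <= w by rewrite /w; nia.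
  have w0 : 0 < w by lia.
  case/dvdnP: us => t ht.
  exists (xn a c), (xn a k), u, s', s, w, (xn w c), (yn w c), t.
  split; first by split; apply/is_pellP => //; eexists.
  split.
    split=> //; first by rewrite ey; apply: pell_congr.
    exact: yn_congr_index.
  split=> //; try by rewrite /k in u_ge; lia.
  apply: leq_trans (yn_ge m a0); rewrite /m; nia.
case=> y' [u' [u [s' [s [w [x' [x [t]]]]]]]].
case=> -[/is_pellP[//|p [_ ey]] /is_pellP[//|k [_ eu]] /is_pellP[//|m [es' es]] hx].
case=> -[w2 hwa hw1 hxy hxc] [lty ltc s0 est].
have w0 : 0 < w by lia.
case/(is_pellP _ _ w0): hx => n [_ ex].
have yn0 b : 0 < b -> yn b 0 = 0 by [].
have k0 : 0 < k by case: k eu => // eu; move: lty; rewrite eu yn0.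
have m0 : 0 < m by case: m es {es'} => // es; move: s0; rewrite es yn0.
have dvd_um : u %| m.
  have := @py_sq_dvd a k m a1' k0 m0.
  rewrite -!ynE // -eu -es !dvdzE; apply.
  by rewrite est dvdn_mull.
have dvd_km : k %| m.
  apply: (@py_dvd a k m) => //; rewrite -!ynE // -eu -es dvdzE /=.
  by rewrite est dvdn_mull ?dvdn_mulr.
have inj_lt i j : yn a i < yn a j -> i < j.
  move=> h; rewrite ltnNge; apply/negP => le_ji.
  by have := py_mono a1' le_ji; rewrite -!ynE // lez_nat; lia.
have le_pm : p <= m.
  apply: leq_trans (dvdn_leq m0 dvd_km); apply: ltnW.
  by apply: inj_lt; rewrite -eu -ey; clear -lty; lia.
have hyn : yn a n = yn a p %[mod s'].
  by rewrite -ey -hxy ex; apply: pell_congr => //; rewrite hwa.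
have [j hj] : exists j, n = j * (2 * m) + p \/ n + p = j * (2 * m).
  apply: (@py_eq_mod a) => //; move/dvdz_eqmod: hyn.
  by rewrite es' !ynE // xnE.
have hnc : n = c %[mod u].
  by rewrite -hxc ex; apply/esym; apply: yn_congr_index.
have le_py : p <= y by rewrite ey yn_ge.
have hmod : j * (2 * m) = 0 %[mod u].
  by apply/eqP; rewrite mod0n; apply: dvdn_mull; apply: dvdn_mull.
(* As u divides m, the index n, and hence c, is p or -p modulo u. Both p and c are below u / 2, so c
   = p, the second sign forcing both to be 0. *)
rewrite ey; congr yn; case: hj => hj.
  have : p = c %[mod u].
    by rewrite -hnc hj -modnDml hmod mod0n add0n.
  rewrite !modn_small //; clear -lty ltc le_py; lia.
have : p + c = 0 %[mod u].
  by rewrite -modnDmr -hnc modnDmr addnC hj.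
rewrite !modn_small //; clear -lty ltc le_py; lia.
Qed.

(** * Exponentiation *)

Lemma dio_yn F G H : dfun F -> dfun G -> dfun H ->
  dio (fun e => 3 <= F e /\ G e = yn (F e) (H e)).
Proof.
apply: (dio_sub3 (R := fun a y c => 3 <= a /\ y = yn a c)).
apply: dio_ext (_ : dio (fun e => 3 <= e 0 /\ exists y' u' u s' s w x' x t,
   [/\ is_pell (e 0) y' (e 1), is_pell (e 0) u' u, is_pell (e 0) s' s & is_pell w x' x] /\
   [/\ 2 <= w, w = e 0 %[mod s'], w = 1 %[mod u], x = e 1 %[mod s'] & x = e 2 %[mod u]] /\
   [/\ 2 * e 1 < u, 2 * e 2 < u, 0 < s & s = t * (u * u)])) _.
  by rewrite /is_pell; dio.
by move=> e; split=> -[e0 h]; split=> //; apply/yn_char.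
Qed.

Ltac dio_fun ::= first [apply: dio_leq | apply: dfun_subn | apply: dfun_divn
  | apply: dfun_modn | apply: dio_dvdn | apply: dio_yn].

Lemma yn_exp b n : 0 < b -> b ^ n <= yn b n.+1.
Proof.
move=> b0; elim: n => [|n IHn]; first exact: yn_ge.
rewrite -lez_nat ynE // pyS -xnE // -ynE // expnS; move: IHn; nia.
Qed.

Lemma pell_expn a k n : 0 < k -> k <= a ->
  xn a n + yn a n * k = k ^ n + yn a n * a %[mod 2 * a * k - (k * k + 1)].
Proof.
move=> k0 le_ka; have a0 : 0 < a by lia.
apply/dvdz_eqmod; have := pell_exp_mod a k n.
by rewrite -xnE // -ynE // !PoszD !PoszM -subzn ?PoszD ?PoszM //; nia.
Qed.

(** [pell_expn] gives k^n modulo 2ak - k^2 - 1, hence k^n itself once a is large. To choose such an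
    a without using powers, it is built from y_(n+1)(k + 3), which is at least k^n by [yn_exp]; the
    shift by 3 meets the condition on the parameter in [yn_char]. *)
Lemma expn_char z k n : 0 < k -> z = k ^ n <->
  exists b a y x, [/\ 3 <= k + 3 /\ b = yn (k + 3) n.+1, a = b + k + 3,
    3 <= a /\ y = yn a n & is_pell a x y] /\
    z < 2 * a * k - (k * k + 1) /\
    x + y * k = z + y * a %[mod 2 * a * k - (k * k + 1)].
Proof.
move=> k0; pose b := yn (k + 3) n.+1; pose a := b + k + 3.
have le_ka : k <= a by rewrite /a; lia.
have ltM : k ^ n < 2 * a * k - (k * k + 1).
  have : k ^ n <= b.
    apply: leq_trans (yn_exp n _); last by lia.
    have [->|n0] := posnP n; first by rewrite !expn0.
    by rewrite leq_exp2r; lia.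
  by rewrite /a; move: (k ^ n) => t; nia.
have a0 : 0 < a by lia.
split=> [->|].
  exists b, a, (yn a n), (xn a n); split; last by split=> //; exact: pell_expn.
  split=> //; first by split=> //; lia.
    by split=> //; rewrite /a; lia.
  by apply/is_pellP => //; exists n.
case=> b' [a' [y [x [[[_ ->] -> [_ ->]]]]]]; rewrite -/b -/a => /is_pellP.
case/(_ a0) => m [-> eqy] [ltz hz].
have inj i j : yn a i = yn a j -> i = j.
  move=> e; apply/eqP; rewrite eqn_leq; have a1 : (1 <= Posz a)%R by lia.
  by apply/andP; split; rewrite leqNgt; apply/negP => h;
    have := py_mono a1 h; rewrite -!ynE // lez_nat;
    [have := py_lt j a1 | have := py_lt i a1]; rewrite -!ynE //; lia.
move/inj: eqy hz => <-; rewrite pell_expn // => /esym /eqP.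
by rewrite eqn_modDr !modn_small // => /eqP.
Qed.

Lemma dfun_expn F G : dfun F -> dfun G -> dfun (fun e => F e ^ G e).
Proof.
apply: (dfun2 (f := expn)).
(* Base 0 is treated apart, as [expn_char] needs a positive base; the first case contains 0^0 =
   1. *)
apply: dio_ext (_ : dio (fun e => (e 2 = 0 /\ e 0 = 1) \/
   (e 1 = 0 /\ 0 < e 2 /\ e 0 = 0) \/ 0 < e 1 /\
   exists b a y x, [/\ 3 <= e 1 + 3 /\ b = yn (e 1 + 3) (e 2).+1, a = b + e 1 + 3,
    3 <= a /\ y = yn a (e 2) & is_pell a x y] /\
    e 0 < 2 * a * e 1 - (e 1 * e 1 + 1) /\
    x + y * e 1 = e 0 + y * a %[mod 2 * a * e 1 - (e 1 * e 1 + 1)])) _.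
  by rewrite /is_pell; dio.
move=> e; have [e2|e2] := posnP (e 2).
  by rewrite e2 expn0; split=> [[[]|[[_ []]|[e1]]] //|]; [move/expn_char; exact | left].
have [e1|e1] := posnP (e 1).
  by rewrite e1 exp0n //; split=> [[[]|[[_ []]|[]]] //|]; [lia | right; left].
split=> [[[]|[[]|[_ /expn_char ->]]] //|h]; try lia.
by right; right; split=> //; apply/expn_char.
Qed.

(** * Digits, binomial coefficients and factorials *)

Ltac dio_fun ::= first [apply: dio_leq | apply: dfun_subn | apply: dfun_divn
  | apply: dfun_modn | apply: dio_dvdn | apply: dfun_expn].

Definition digit (c B k : nat) := c %/ B ^ k %% B.

Lemma dfun_digit F G H : dfun F -> dfun G -> dfun H ->
  dfun (fun e => digit (F e) (G e) (H e)).
Proof. by rewrite /digit => hF hG hH; dio. Qed.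

Lemma digit_sum n B (d : nat -> nat) k : k < n -> (forall i, i < n -> d i < B) ->
  digit (\sum_(i < n) d i * B ^ i) B k = d k.
Proof.
rewrite /digit; elim: n d k => // n IHn d k ltkn hd.
have B0 : 0 < B by apply: leq_ltn_trans (hd 0 _).
rewrite big_ord_recl expn0 muln1.
under eq_bigr => i _ do rewrite lift0 expnSr mulnA.
rewrite -big_distrl /= addnC; case: k ltkn => [|k] ltkn.
  by rewrite expn0 divn1 modnMDl modn_small ?hd.
rewrite expnS divnMA divnMDl // [X in (_ + X) %/ _]divn_small ?hd // addn0.
by apply: (IHn (fun i => d i.+1)) => // i lti; apply: hd.
Qed.

Lemma bin_digit n k : 'C(n, k) = digit ((1 + (2 ^ n).+1) ^ n) (2 ^ n).+1 k.
Proof.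
have bin_lt i : 'C(n, i) < (2 ^ n).+1.
  rewrite ltnS -[2]/(1 + 1) expnDn.
  have [lt_ni|le_in] := ltnP n i; first by rewrite bin_small.
  rewrite (bigD1 (Ordinal (le_in : i < n.+1))) //= !exp1n !muln1; exact: leq_addr.
have [le_kn|lt_nk] := leqP k n.
  rewrite expnDn; under eq_bigr => i _ do rewrite exp1n mul1n.
  by rewrite digit_sum.
(* Beyond the last digit: with B = 2^n + 1, (1 + B)^n <= (2B)^n < B^(n + 1). *)
rewrite bin_small // /digit divn_small //.
apply: leq_trans (leq_pexp2l _ lt_nk) => //; rewrite expnS.
apply: leq_ltn_trans (_ : (2 ^ n) * (2 ^ n).+1 ^ n < _).
  by rewrite -expnMn; case: n {lt_nk bin_lt} => [|n] //; rewrite leq_exp2r; lia.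
by rewrite ltn_pmul2r // expn_gt0.
Qed.

Lemma dfun_bin F G : dfun F -> dfun G -> dfun (fun e => 'C(F e, G e)).
Proof.
apply: (dfun2 (f := binomial)); apply: dfun_ext (_ : dfun (fun e => _)) _.
  2: by move=> e; exact/esym/bin_digit.
by rewrite /digit; dio.
Qed.

Lemma leq_ffact_exp r n : r ^_ n <= r ^ n.
Proof.
rewrite ffact_prod -[X in _ <= _ ^ X]card_ord -prod_nat_const.
by apply: leq_prod => i _; apply: leq_subr.
Qed.

Lemma leq_exp_ffact r n : (r - n) ^ n <= r ^_ n.
Proof.
rewrite ffact_prod -[X in _ ^ X]card_ord -prod_nat_const.
by apply: leq_prod => i _; apply: leq_sub2l; exact: ltnW.
Qed.

(** A mean value estimate; it serves to bound r^n - (r - n)^n by n^2 r^(n - 1). *)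
Lemma exp_add_le x d n : (x + d) ^ n.+1 <= x ^ n.+1 + n.+1 * d * (x + d) ^ n.
Proof.
elim: n => [|n IHn]; first by rewrite !expn0 !expn1; lia.
have : x ^ n.+1 <= (x + d) ^ n.+1 by rewrite leq_exp2r // leq_addr.
move: IHn; rewrite ![_ ^ n.+2]expnS; rewrite [(x + d) ^ n.+1]expnS.
move: (x ^ n.+1) ((x + d) ^ n) => u v; nia.
Qed.

(** The remainder r^n - n! C(r, n) is r^n minus a falling factorial, hence at most n^2 r^(n - 1),
    which is below C(r, n) as soon as r > n^2 (n! + 1). The bound on r uses n^n in place of n!,
    whose graph is still to be described. *)
Lemma fact_divn n r : n * n * (n ^ n + 1) + n < r -> n`! = r ^ n %/ 'C(r, n).
Proof.
case: n => [|m]; first by rewrite bin0 expn0.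
set n := m.+1; move=> ltr.
have lefn : n`! <= n ^ n by rewrite -ffactnn leq_ffact_exp.
have lt_nr : n <= r by lia.
have c0 : 0 < 'C(r, n) by rewrite bin_gt0.
have f0 := fact_gt0 n.
have h1 := leq_ffact_exp r n; have h2 := leq_exp_ffact r n.
have := exp_add_le (r - n) n m; rewrite subnK // => h3.
rewrite -bin_ffact in h1 h2; rewrite -/n in h3.
have lt_c : n * n * r ^ m < 'C(r, n).
  have rm0 : 0 < r ^ m by rewrite expn_gt0; lia.
  have h4 : (n * n * (n`! + 1)) * r ^ m < r * r ^ m.
    by rewrite ltn_pmul2r //; nia.
  have er : r ^ n = r * r ^ m by rewrite expnS.
  rewrite -(ltn_pmul2r f0); move: h2 h3 h4; rewrite er; clear.
  move: (r ^ m) ((r - n) ^ n) 'C(r, n) n`! => u v c f; clear; nia.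
have -> : r ^ n = n`! * 'C(r, n) + (r ^ n - n`! * 'C(r, n)) by rewrite mulnC; lia.
rewrite divnMDl // divn_small ?addn0 //; clear h1; lia.
Qed.

Lemma dfun_fact F : dfun F -> dfun (fun e => (F e)`!).
Proof.
apply: (dfun1 (f := factorial)).
pose r n := (n * n * (n ^ n + 1) + n).+1.
apply: dfun_ext (_ : dfun (fun e => _)) _.
  2: by move=> e; apply/esym/(fact_divn (r := r (e 0))).
by rewrite /r; dio; apply: dfun_bin; dio.
Qed.

(** * Bounded universal quantification *)

Ltac dio_fun ::= first [apply: dio_leq | apply: dfun_subn | apply: dfun_divn
  | apply: dfun_modn | apply: dio_dvdn | apply: dfun_expn | apply: dfun_digit
  | apply: dfun_bin | apply: dfun_fact].

Lemma finite_choice (T : Type) (t : T) (P : nat -> T -> Prop) n :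
  (forall k, k < n -> exists x, P k x) -> exists F, forall k, k < n -> P k (F k).
Proof.
elim: n => [|n IHn] h; first by exists (fun=> t).
have [k ltk|F hF] := IHn; first by apply: h; apply: ltnW.
have [x hx] := h n (ltnSn n); exists (fun k => if k == n then x else F k) => k.
by rewrite ltnS leq_eqVlt; case: eqVneq => [->|_ /= /hF].
Qed.

Lemma coprime_prod n (m : nat -> nat) k :
  (forall i, i < n -> coprime (m i) k) -> coprime (\prod_(i < n) m i) k.
Proof.
move=> h; elim: n h => [|n IHn] h; first by rewrite big_ord0 coprime1n.
by rewrite big_ord_recr coprimeMl /= IHn ?h // => i /ltnW /h.
Qed.

Definition pairwise_coprime n (m : nat -> nat) :=
  forall i j, i < j -> j < n -> coprime (m i) (m j).

Lemma prod_coprime_dvd n (m : nat -> nat) a : pairwise_coprime n m ->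
  (forall i, i < n -> m i %| a) -> \prod_(i < n) m i %| a.
Proof.
elim: n => [|n IHn] cop h; first by rewrite big_ord0 dvd1n.
rewrite big_ord_recr /= Gauss_dvd ?h ?andbT //.
  by apply: IHn => [i j ltij ltj|i lti]; [apply: cop | apply: h]; lia.
by apply: coprime_prod => i lti; apply: cop.
Qed.

Lemma eqmod_prod n (m : nat -> nat) x y : pairwise_coprime n m ->
  (forall i, i < n -> x = y %[mod m i]) -> x = y %[mod \prod_(i < n) m i].
Proof.
move=> cop; wlog le_yx : x y / y <= x => [hwlog|h].
  have [/hwlog|/ltnW/hwlog h /[dup] h1] := leqP y x; first exact.
  by move=> ?; apply/esym/h => i /h1.
apply/eqP; rewrite eqn_mod_dvd //; apply: prod_coprime_dvd => // i lti.
by rewrite -eqn_mod_dvd //; apply/eqP; exact: h.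
Qed.

Lemma crt n (m r : nat -> nat) : pairwise_coprime n m ->
  exists a, forall i, i < n -> a = r i %[mod m i].
Proof.
elim: n => [|n IHn] cop; first by exists 0.
have [a ha] : exists a, forall i, i < n -> a = r i %[mod m i].
  by apply: IHn => i j ltij ltj; apply: cop => //; lia.
have copn : coprime (\prod_(i < n) m i) (m n).
  by apply: coprime_prod => i lti; apply: cop.
exists (chinese (\prod_(i < n) m i) (m n) a (r n)) => i.
rewrite ltnS leq_eqVlt => /predU1P[->|lti]; first exact: chinese_modr.
rewrite -ha //; have /dvdnP[c hc] : m i %| \prod_(i < n) m i.
  by rewrite (bigD1 (Ordinal lti)) //= dvdn_mulr.
have := chinese_modl copn a (r n); set z := chinese _ _ _ _.
by move/(congr1 (fun t => t %% m i)); rewrite hc !modn_dvdm // dvdn_mull.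
Qed.

(** As q / i + 1 = (q + i) / i, the product is (q + 1) ... (q + n) / n!. *)
Lemma prod_succ_divn q n : (forall i, i < n -> i.+1 %| q) ->
  \prod_(i < n) (q %/ i.+1).+1 = 'C(q + n, n).
Proof.
elim: n => [|n IHn] h; first by rewrite big_ord0 bin0.
rewrite big_ord_recr /= IHn => [|i lti]; last by apply: h; lia.
apply/eqP; rewrite -(eqn_pmul2l (ltn0Sn n)) addnS -mul_bin_diag; apply/eqP.
have := divnK (h n (ltnSn n)); move: (q %/ n.+1) 'C(q + n, n) => a b; nia.
Qed.

Lemma coprime_primes a b : 0 < a ->
  (forall p, prime p -> p %| a -> p %| b -> False) -> coprime a b.
Proof.
move=> a0 h; rewrite /coprime eqn_leq gcdn_gt0 a0 andbT leqNgt.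
apply/negP => /pdiv_prime pr; have := pdiv_dvd (gcdn a b).
by rewrite dvdn_gcd => /andP[]; exact: h.
Qed.

Lemma prime_dvd_fact p u : prime p -> p %| u`! -> p <= u.
Proof.
move=> pr_p; elim: u => [|u IHu].
  by rewrite dvdn1 => /eqP p1; rewrite p1 in pr_p.
by rewrite factS Euclid_dvdM // => /orP[/dvdn_leq|/IHu/leqW]; [apply|].
Qed.

(* As every i <= n is at most w and q = (w!)^2, the numbers 1 + q / i are pairwise
   coprime, without prime factors up to w, and their product is a binomial coefficient. *)
Section GodelModuli.
Variables w n : nat.
Hypothesis le_nw : n <= w.
Let q := w`! ^ 2.
Let m i := (q %/ i.+1).+1.

Lemma modulus_dvd i : i < n -> i.+1 %| q.
Proof. by move=> lti; apply: dvdn_mulr; apply: dvdn_fact; lia. Qed.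

Lemma modulus_mul i : i < n -> i.+1 * m i = q + i.+1.
Proof. by move=> lti; rewrite mulnS mulnC divnK ?modulus_dvd // addnC. Qed.

Lemma modulus_prime i p : i < n -> prime p -> p %| m i -> w < p.
Proof.
move=> lti pr_p dvd_p; rewrite ltnNge; apply/negP => le_pw.
have : p %| q %/ i.+1.
  (* The square is needed here: after division by i + 1 a full factor w! remains. *)
  rewrite /q expnS expn1 -muln_divA; last by apply: dvdn_fact; lia.
  by apply: dvdn_mulr; apply: dvdn_fact; rewrite prime_gt0.
move=> hq; move: dvd_p; rewrite /m -addn1 dvdn_addr // dvdn1 => /eqP p1.
by rewrite p1 in pr_p.
Qed.

Lemma modulus_coprime : pairwise_coprime n m.
Proof.
move=> i j ltij ltj; have lti : i < n by lia.
apply: coprime_primes => // p pr_p pi pj.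
have lt_wp := modulus_prime lti pr_p pi.
have hi : p %| q + i.+1 by rewrite -modulus_mul // dvdn_mull.
have hj : p %| q + j.+1 by rewrite -modulus_mul // dvdn_mull.
(* The prime p divides j - i, which is positive and below n <= w < p. *)
have := dvdn_sub hj hi; rewrite subnDl => /dvdn_leq; lia.
Qed.

Lemma modulus_prod : \prod_(i < n) m i = 'C(q + n, n).
Proof. by apply: prod_succ_divn; exact: modulus_dvd. Qed.

End GodelModuli.

(** A prime divisor of a(a - 1) ... (a - u + 1) divides some factor a - y; if a < u, the product is
    0 and a itself serves as y. *)
Lemma dvd_ffact_mod p a u : prime p -> p %| a ^_ u -> exists2 y, y < u & a = y %[mod p].
Proof.
move=> pr_p; have [lt_au|le_ua] := ltnP a u; first by exists a.
elim: u le_ua => [|u IHu] le_ua.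
  by rewrite ffactn0 dvdn1 => /eqP p1; rewrite p1 in pr_p.
rewrite ffactnSr Euclid_dvdM // => /orP[/IHu[|y lt_y hy]|h]; first by lia.
  by exists y => //; lia.
by exists u => //; apply/eqP; rewrite eqn_mod_dvd // ltnW.
Qed.

Lemma sub_dvd_ffact a y u : y < u -> y <= a -> a - y %| a ^_ u.
Proof.
by move=> lt_yu le_ya; rewrite ffact_prod (bigD1 (Ordinal lt_yu)) //= dvdn_mulr.
Qed.

(* The residue of f i modulo the k-th modulus is the i-th witness for k; divisibility of
   C(f i, u) by M says that all these residues are below u modulo prime factors, and
   j = -q-1 represents all the k simultaneously.  A congruence modulo a prime above w
   between numbers at most w is an equality. *)
Lemma ball_code (s t : term) e n :
  (forall k, k < n -> exists f, ev (scons k e) f s = ev (scons k e) f t) <->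
  exists u f j,
    let w := ev (scons n e) (fun=> u) (Add s t) + u + n in
    let q := w`! ^ 2 in let M := 'C(q + n, n) in
    (forall i, i < tbound (Add s t) -> M %| 'C(f i, u)) /\
    M %| j + q + 1 /\ ev (scons j e) f s = ev (scons j e) f t %[mod M].
Proof.
set l := tbound _; split.
  move=> h; have [F hF] := finite_choice (fun=> 0) h.
  pose u := (\max_(k < n) \max_(i < l) F k i).+1.
  have ltu k i : k < n -> i < l -> F k i < u.
    move=> ltk lti; rewrite ltnS; apply: leq_trans (leq_bigmax (Ordinal ltk)).
    exact: (leq_bigmax (F := fun i : 'I_l => F k i) (Ordinal lti)).
  (* By monotonicity this bounds both sides of the equation for every k < n and all unknowns up to
     u. *)
  pose w := ev (scons n e) (fun=> u) (Add s t) + u + n.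
  pose q := w`! ^ 2; pose m i := (q %/ i.+1).+1.
  have le_nw : n <= w by rewrite leq_addl.
  have cop : pairwise_coprime n m by exact: modulus_coprime.
  have [|f hf] := @finite_choice _ 0
      (fun i a => forall k, k < n -> a = F k i %[mod m k]) l.
    by move=> i _; exact: (crt (fun k => F k i) cop).
  have Mprod : 'C(q + n, n) = \prod_(i < n) m i by rewrite modulus_prod.
  have M0 : 0 < 'C(q + n, n) by rewrite bin_gt0 leq_addl.
  (* With this j, j + q + 1 is q + 1 times the binomial coefficient. *)
  exists u, f, ((q + 1) * ('C(q + n, n)).-1); split; last split.
  - move=> i lti; rewrite -/w -/q Mprod; apply: prod_coprime_dvd => // k ltk.
    have [lt_u|le_u] := ltnP (f i) u; first by rewrite bin_small.
    (* The prime factors of [m k] exceed w >= u, so it is enough to divide the falling factorial. *)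
    have cu : coprime (m k) u`!.
      apply: coprime_primes => // p pr_p /(modulus_prime le_nw ltk pr_p) lt_wp.
      by move/(prime_dvd_fact pr_p); move: lt_wp; rewrite /w; lia.
    rewrite -(Gauss_dvdl _ cu) bin_ffact.
    have lt_Fu := ltu _ _ ltk lti.
    apply: dvdn_trans (sub_dvd_ffact lt_Fu _); last by lia.
    by rewrite -eqn_mod_dvd; [apply/eqP; exact: hf | lia].
  - by rewrite -/w -/q -addnA -mulnSr prednK // dvdn_mull.
  rewrite -/w -/q; set j := (q + 1) * _.
  have hj : 'C(q + n, n) %| j + q + 1.
    by rewrite /j -addnA -mulnSr prednK // dvdn_mull.
  have key k : k < n -> ev (scons j e) f s = ev (scons j e) f t %[mod m k].
    (* Both j + q + 1 and k + q + 1 = (k + 1) m_k are multiples of m_k. *)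
    move=> ltk; have hjk : j = k %[mod m k].
      apply/eqP; rewrite -(eqn_modDr (q + 1)) !addnA; apply/eqP.
      have /dvdnP[c ->] : m k %| j + q + 1.
        apply: dvdn_trans hj; rewrite Mprod (bigD1 (Ordinal ltk)) //=.
        exact: dvdn_mulr.
      have -> : k + q + 1 = k.+1 * m k by rewrite [RHS](modulus_mul le_nw ltk) -/q; lia.
      by rewrite !modnMl.
    have he i : scons j e i = scons k e i %[mod m k] by case: i.
    have red r : (forall i, i < tbound r -> i < l) ->
        ev (scons j e) f r = ev (scons k e) (F k) r %[mod m k].
      by move=> hr; apply: ev_mod => // i /hr lti; exact: hf.
    by rewrite !red ?hF // => i lti; rewrite /l leq_max lti ?orbT.
  by rewrite Mprod; apply: eqmod_prod.
case=> u [f [j]]; cbv zeta.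
set w := _ + u + n; set q := _ ^ 2; set M := 'C(_, _) => -[hf [hj hst]] k ltk.
pose m i := (q %/ i.+1).+1.
have le_nw : n <= w by rewrite leq_addl.
have q0 : k < q.
  rewrite /q expnS expn1; have := fact_gt0 w; have := leq_trans ltk le_nw.
  have := dvdn_leq (fact_gt0 w) (dvdn_fact (_ : 0 < w <= w)); nia.
have m1 : 1 < m k by rewrite ltnS divn_gt0.
(* A single prime factor suffices: primality splits the falling factorials, and p > w exceeds both
   sides of the equation. *)
have pr_p := pdiv_prime m1; set p := pdiv _ in pr_p.
have lt_wp := modulus_prime le_nw ltk pr_p (pdiv_dvd _).
have dvd_pM : p %| M.
  rewrite /M -modulus_prod // (bigD1 (Ordinal ltk)) //=.
  by apply: dvdn_mulr; exact: pdiv_dvd.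
have hjk : j = k %[mod p].
  apply/eqP; rewrite -(eqn_modDr (q + 1)) !addnA.
  have -> : k + q + 1 = k.+1 * m k by rewrite [RHS](modulus_mul le_nw ltk) -/q; lia.
  have /dvdnP[c ->] := dvdn_trans dvd_pM hj.
  have /dvdnP[d ->] : p %| m k by exact: pdiv_dvd.
  by rewrite mulnA !modnMl.
have [|g hg] := @finite_choice _ 0 (fun i y => y < u /\ f i = y %[mod p]) l.
  move=> i lti; have [|y lt_yu hy] := @dvd_ffact_mod p (f i) u pr_p; last by exists y.
  rewrite -bin_ffact; apply: dvdn_mulr; exact: dvdn_trans dvd_pM (hf i lti).
exists g.
have he i : scons j e i = scons k e i %[mod p] by case: i.
have hes i : scons k e i <= scons n e i by case: i => //=; exact: ltnW.
have mods r : (forall i, i < tbound r -> i < l) ->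
    ev (scons j e) f r = ev (scons k e) g r %[mod p].
  by move=> hr; apply: ev_mod => // i /hr /hg[].
have les r : (forall i, i < tbound r -> i < l) ->
    ev (scons k e) g r <= ev (scons n e) (fun=> u) r.
  by move=> hr; apply: ev_mono => // i /hr /hg[/ltnW].
have ls i : i < tbound s -> i < l by move=> lti; rewrite leq_max lti.
have lt i : i < tbound t -> i < l by move=> lti; rewrite leq_max lti orbT.
have : ev (scons k e) g s = ev (scons k e) g t %[mod p].
  rewrite -!mods //; have := congr1 (fun x => x %% p) hst.
  by rewrite /= !modn_dvdm.
have := les s ls; have := les t lt; move: lt_wp; rewrite /w /= => lt_wp l1 l2.
rewrite !modn_small //; clear -lt_wp l1 l2; lia.
Qed.

Lemma dio_ex_fun (R : (nat -> nat) -> (nat -> nat) -> Prop) :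
  dio (fun e => R (fun i => e i.*2) (fun i => e i.*2.+1)) ->
  dio (fun e => exists f, R f e).
Proof.
move/dio_exf=> h; apply: dio_ext h _ => e.
have Ef f : (fun i => interleave f e i.*2) = f.
  by apply: functional_extensionality => i; exact: interleave_even.
have Ee f : (fun i => interleave f e i.*2.+1) = e.
  by apply: functional_extensionality => i; exact: interleave_odd.
by split=> -[f hf]; exists f; move: hf; rewrite Ef Ee.
Qed.

Lemma dfun_ev (a b : (nat -> nat) -> nat -> nat) t :
  (forall i, dfun (fun e => a e i)) -> (forall i, dfun (fun e => b e i)) ->
  dfun (fun e => ev (a e) (b e) t).
Proof.
by move=> ha hb; elim: t => //= [||s IHs t IHt|s IHs t IHt]; dio.
Qed.

Lemma dfun_scons_at F (G : (nat -> nat) -> nat -> nat) i :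
  dfun F -> (forall j, dfun (fun e => G e j)) -> dfun (fun e => scons (F e) (G e) i).
Proof. by move=> hF hG; case: i => [|i]; [exact: hF | exact: hG]. Qed.

Ltac dio_fun ::= first [apply: dio_leq | apply: dfun_subn | apply: dfun_divn
  | apply: dfun_modn | apply: dio_dvdn | apply: dfun_expn | apply: dfun_digit
  | apply: dfun_bin | apply: dfun_fact | apply: dfun_ev | apply: dfun_scons_at].

Lemma dio_ball (S : nat -> (nat -> nat) -> Prop) N :
  dio (fun e => S (e 0) (fun i => e i.+1)) -> dfun N ->
  dio (fun e => forall k, k < N e -> S k e).
Proof.
case=> s [t hST] hN.
have hS k e : S k e <-> exists f, ev (scons k e) f s = ev (scons k e) f t.
  exact: (hST (scons k e)).
apply: dio_ext (_ : dio (fun e => exists n, n = N e /\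
  exists u f j,
    let w := ev (scons n e) (fun=> u) (Add s t) + u + n in
    let q := w`! ^ 2 in let M := 'C(q + n, n) in
    (forall i, i < tbound (Add s t) -> M %| 'C(f i, u)) /\
    M %| j + q + 1 /\ ev (scons j e) f s = ev (scons j e) f t %[mod M])) _; last first.
  move=> e; split=> [[n [-> /ball_code h]] k ltk|h]; first exact/hS/h.
  by exists (N e); split=> //; apply/ball_code => k ltk; apply/hS/h.
have hn : dfun (fun e => N (fun i => e i.+1)) by exact: dfun_shift.
apply: dio_ex; apply: dio_and; first by dio.
apply: dio_ex; apply: dio_ex_fun; apply: dio_ex; cbv beta zeta.
apply: dio_and; first by apply: dio_all; dio.
by apply: dio_and; dio.
Qed.

(** * Graphs of partial recursive functions *)

Definition env_tuple n (e : nat -> nat) : n.-tuple nat := [tuple e i.+1 | i < n].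
Definition dgraph n (f : parrec n) := dio (fun e => computes f (env_tuple n e) (e 0)).

Lemma nth_env_tuple n e i : i < n -> nth 0 (env_tuple n e) i = e i.+1.
Proof. by move=> lti; rewrite -[i]/(val (Ordinal lti)) -tnth_nth tnth_mktuple. Qed.

Lemma dfun_ren (r : nat -> nat) F : dfun F -> dfun (fun e => F (fun i => e (r i))).
Proof. by move=> hF; apply: (dfun_sub hF) => i; exact: dfun_proj. Qed.

Lemma dfun_nth_env n i : dfun (fun e => nth 0 (env_tuple n e) i).
Proof.
have [lti|le] := ltnP i n.
  by apply: dfun_ext (dfun_proj i.+1) _ => e; rewrite nth_env_tuple.
by apply: dfun_ext (dfun_const 0) _ => e; rewrite nth_default // size_tuple.
Qed.

Lemma dio_computes n (f : parrec n) (v : (nat -> nat) -> n.-tuple nat) F :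
  dgraph f -> (forall i, dfun (fun e => nth 0 (v e) i)) -> dfun F ->
  dio (fun e => computes f (v e) (F e)).
Proof.
move=> hf hv hF.
pose s i (e : nat -> nat) := if i is j.+1 then nth 0 (v e) j else F e.
have hs i : dfun (s i) by case: i.
apply: dio_ext (dio_sub hf hs) _ => e.
suff -> : env_tuple n (fun i => s i e) = v e by [].
by apply: eq_from_tnth => i; rewrite tnth_mktuple /= -tnth_nth.
Qed.

Lemma dio_forall_ord m (S : 'I_m -> (nat -> nat) -> Prop) :
  (forall i, dio (S i)) -> dio (fun e => forall i, S i e).
Proof.
move=> hS.
apply: dio_ext (dio_all (m := m) (S := fun i e => forall lti : i < m, S (Ordinal lti) e) _) _.
  move=> i lti; apply: dio_ext (hS (Ordinal lti)) _ => e.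
  by split=> [h lti'|]; [rewrite (bool_irrelevance lti' lti) | apply].
by move=> e; split=> [h [i lti]|h i lti lti']; [exact: h | exact: h].
Qed.

Lemma exists_digits n (s : nat -> nat) :
  exists c B, forall k, k < n -> digit c B k = s k.
Proof.
pose B := (\max_(i < n) s i).+1.
exists (\sum_(i < n) s i * B ^ i), B => k ltk; apply: digit_sum => // i lti.
by rewrite ltnS; exact: (leq_bigmax (F := fun i : 'I_n => s i) (Ordinal lti)).
Qed.

(** The sequence of intermediate values becomes the digits of one number c in a base B, and its
    recursion law a bounded quantifier. *)
Lemma dgraph_rec n (g : parrec n) (h : parrec n.+2) :
  dgraph g -> dgraph h -> dgraph (PRec g h).
Proof.
move=> hg hh.
pose x (e : nat -> nat) := [tuple of behead (env_tuple n.+1 e)] : n.-tuple nat.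
have hx i : dfun (fun e => nth 0 (x e) i).
  by apply: dfun_ext (dfun_nth_env n.+1 i.+1) _ => e; rewrite nth_behead.
apply: dio_ext (_ : dio (fun e => exists c B,
  [/\ computes g (x e) (digit c B 0),
      forall k, k < nth 0 (env_tuple n.+1 e) 0 ->
        computes h [tuple of k :: digit c B k :: x e] (digit c B k.+1)
    & e 0 = digit c B (nth 0 (env_tuple n.+1 e) 0)])) _.
  apply: dio_ex; apply: dio_ex; cbv beta.
  have hx2 i : dfun (fun e => nth 0 (x (fun i => e i.+2)) i).
    exact: (dfun_ren (fun i => i.+2) (hx i)).
  have hx3 i : dfun (fun e => nth 0 (x (fun i => e i.+3)) i).
    exact: (dfun_ren (fun i => i.+3) (hx i)).
  have h2 : dfun (fun e => nth 0 (env_tuple n.+1 (fun i => e i.+2)) 0).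
    exact: (dfun_ren (fun i => i.+2) (dfun_nth_env n.+1 0)).
  apply: dio_and3.
  - by apply: dio_computes => //; dio.
  - apply: dio_ball => //; cbv beta; apply: dio_computes => //; last by dio.
    by case=> [|[|i]] /=; [dio | dio | exact: hx3].
  by dio.
move=> e; rewrite /=; have -> : thead (env_tuple n.+1 e) = nth 0 (env_tuple n.+1 e) 0.
  by rewrite /thead (tnth_nth 0).
split.
  case=> c [B [h0 hS ->]]; exists (digit c B); split=> //.
case=> s [h0 hS ->].
(* One digit more than the number of recursion steps, for the initial value. *)
have [c [B cB]] := exists_digits (nth 0 (env_tuple n.+1 e) 0).+1 s.
exists c, B; split; rewrite ?cB // => k ltk.
have ck : digit c B k = s k by apply: cB; exact: ltnW.
by rewrite ck cB ?ltnS //; exact: hS.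
Qed.

Lemma dgraph_mu n (f : parrec n.+1) : dgraph f -> dgraph (PMu f).
Proof.
move=> hf; rewrite /dgraph /=; apply: dio_and.
  apply: dio_computes => //; last by dio.
  by case=> [|i] /=; [dio | exact: dfun_nth_env].
apply: dio_ball; last by dio.
cbv beta; apply: dio_ex; cbv beta; apply: dio_computes => //; last by dio.
case=> [|i] /=; first by dio.
exact: (dfun_ren (fun i => i.+2) (dfun_nth_env n i)).
Qed.

Lemma dgraph_comp m n (g : parrec m) (h : 'I_m -> parrec n) :
  dgraph g -> (forall i, dgraph (h i)) -> dgraph (PComp g h).
Proof.
move=> hg hh; rewrite /dgraph /=.
apply: dio_ext (_ : dio (fun e => exists w : nat -> nat,
  (forall i : 'I_m, computes (h i) (env_tuple n e) (w i)) /\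
  computes g [tuple w i | i < m] (e 0))) _.
  apply: dio_ex_fun; cbv beta; apply: dio_and.
    apply: dio_forall_ord => i; apply: dio_computes => //; last by dio.
    by move=> j; exact: (dfun_ren (fun i => i.*2.+1) (dfun_nth_env n j)).
  apply: dio_computes => //; last by dio.
  move=> i; have [lti|le] := ltnP i m.
    apply: dfun_ext (dfun_proj i.*2) _ => e.
    by rewrite -[i in RHS]/(val (Ordinal lti)) -tnth_nth tnth_mktuple.
  by apply: dfun_ext (dfun_const 0) _ => e; rewrite nth_default // size_tuple.
move=> e; split=> [[w [hw gw]]|[w [hw gw]]].
  by exists [tuple w i | i < m]; split=> // i; rewrite tnth_mktuple.
exists (nth 0 w); split=> [i|]; first by rewrite -tnth_nth.
suff -> : [tuple nth 0 w i | i < m] = w by [].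
by apply: eq_from_tnth => i; rewrite tnth_mktuple -tnth_nth.
Qed.

Lemma dio_parrec n (f : parrec n) : dgraph f.
Proof.
elim: f => {n} [n||n i|m n g hg h hh|n g hg h hh|n f hf].
- by rewrite /dgraph /=; dio.
- apply: dio_ext (_ : dio (fun e => e 0 = (e 1).+1)) _; first by dio.
  by move=> e; rewrite /= /thead tnth_mktuple.
- apply: dio_ext (_ : dio (fun e => e 0 = e i.+1)) _; first by dio.
  by move=> e; rewrite /= tnth_mktuple.
- exact: dgraph_comp.
- exact: dgraph_rec.
- exact: dgraph_mu.
Qed.

(** * Reduction to a quadratic system *)

(* [(i, j, k, l)] stands for the constraint [z i * z j = z k + z l]. *)
Definition quad : Type := nat * nat * nat * nat.

Definition qsat (z : nat -> nat) (c : quad) : bool :=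
  let: (i, j, k, l) := c in z i * z j == z k + z l.

Definition qbound (n : nat) (c : quad) : bool :=
  let: (i, j, k, l) := c in [&& i < n, j < n, k < n & l < n].

Lemma qsat_eq n z z' cs : (forall i, i < n -> z i = z' i) ->
  all (qbound n) cs -> all (qsat z) cs -> all (qsat z') cs.
Proof.
move=> zz'; elim: cs => //= -[[[i j] k] l] cs IHcs /andP[/and4P[hi hj hk hl] hb].
by case/andP=> /= h /(IHcs hb) ->; rewrite -!zz' // h.
Qed.

Lemma qbound_leq n n' cs : n <= n' -> all (qbound n) cs -> all (qbound n') cs.
Proof.
move=> le_nn'; apply: sub_all => -[[[i j] k] l] /and4P[hi hj hk hl].
by rewrite /=; apply/and4P; split; lia.
Qed.

(* The constant 1 is [z 0], every parameter is read from [z 1], the constant 0 is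
   [z 2], and the unknown number i is [z i.+3]. *)
Definition zwf (z : nat -> nat) := z 0 = 1 /\ z 2 = 0.
Definition zev (z : nat -> nat) t := ev (fun=> z 1) (fun i => z i.+3) t.

(* [v z] can be read off as the value of an additional variable subject to constraints
   that never restrict the first [n0] variables. *)
Definition flattens (n0 : nat) (v : (nat -> nat) -> nat) := exists cs r n,
  [/\ n0 <= n, r < n, all (qbound n) cs,
      forall z, zwf z -> all (qsat z) cs -> z r = v z
    & forall z, zwf z -> exists z', (forall i, i < n0 -> z' i = z i) /\ all (qsat z') cs].

Lemma zwf_eq n z z' : 3 <= n -> (forall i, i < n -> z' i = z i) -> zwf z -> zwf z'.
Proof. by move=> le3 zz' [z0 z2]; split; rewrite zz' //; lia. Qed.

(** [w] must be flattenable above any bound, so that its auxiliary variables avoid those of [v];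
    variable number [n2] then receives the result. *)
Lemma flatten_op (op : nat -> nat -> nat) (c : nat -> nat -> nat -> quad) n0 v w :
  3 <= n0 ->
  (forall z i j k, zwf z -> qsat z (c i j k) = (z k == op (z i) (z j))) ->
  (forall n i j k, 3 <= n -> i < n -> j < n -> k < n -> qbound n (c i j k)) ->
  flattens n0 v -> (forall n, n0 <= n -> flattens n w) ->
  flattens n0 (fun z => op (v z) (w z)).
Proof.
move=> le3 csat cbound [cs1 [r1 [n1 [le1 lt1 b1 sat1 ex1]]]].
case/(_ n1 le1)=> cs2 [r2 [n2 [le2 lt2 b2 sat2 ex2]]].
exists (c r1 r2 n2 :: cs1 ++ cs2), n2, n2.+1.
have lt1' : r1 < n2 by lia.
have b12 : all (qbound n2) (cs1 ++ cs2).
  by rewrite all_cat b2 andbT; exact: qbound_leq b1.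
split; try lia.
- by rewrite /= cbound ?(qbound_leq _ b12) //; lia.
- move=> z hz; rewrite /= csat // all_cat => /and3P[/eqP -> h1 h2].
  by rewrite (sat1 _ hz h1) (sat2 _ hz h2).
move=> z hz; have [z1 [e1 h1]] := ex1 z hz.
have hz1 : zwf z1 by apply: zwf_eq e1 hz.
have [z2 [e2 h2]] := ex2 z1 hz1.
have hz2 : zwf z2 by apply: zwf_eq e2 hz1; lia.
have h12 : all (qsat z2) (cs1 ++ cs2).
  by rewrite all_cat h2 andbT; apply: qsat_eq b1 h1 => i lti; rewrite e2.
pose z3 i := if i == n2 then op (z2 r1) (z2 r2) else z2 i.
have e3 i : i < n2 -> z3 i = z2 i by move=> lti; rewrite /z3 ltn_eqF.
have hz3 : zwf z3 by apply: zwf_eq e3 hz2; lia.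
exists z3; split=> [i lti|]; first by rewrite e3 ?e2 ?e1 //; lia.
rewrite /= csat // (e3 r1) // (e3 r2) // {1}/z3 !eqxx /=.
by apply: qsat_eq b12 h12 => i lti; rewrite e3.
Qed.

Lemma flatten_term t n0 : 3 + tbound t <= n0 -> flattens n0 (fun z => zev z t).
Proof.
elim: t n0 => [i|i|||s IHs t IHt|s IHs t IHt] n0 /= le_n0.
- by exists [::], 1, n0; split=> //; [lia | move=> z _; exists z].
- by exists [::], i.+3, n0; split=> //; move=> z _; exists z.
- by exists [::], 2, n0; split=> //; [move=> z [] | move=> z _; exists z].
- by exists [::], 0, n0; split=> //; [lia | move=> z [] | move=> z _; exists z].
- apply: (@flatten_op addn (fun i j k => (0, k, i, j))).
  + by lia.
  + by move=> z i j k [z0 _]; rewrite /= z0 mul1n.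
  + by move=> n i j k *; apply/and4P; split; lia.
  + by apply: IHs; lia.
  by move=> n le_n; apply: IHt; lia.
apply: (@flatten_op muln (fun i j k => (i, j, k, 2))).
- by lia.
- by move=> z i j k [_ z2]; rewrite /= z2 addn0 eq_sym.
- by move=> n i j k *; apply/and4P; split; lia.
- by apply: IHs; lia.
by move=> n le_n; apply: IHt; lia.
Qed.

Lemma flatten_dio (S : nat -> Prop) : dio (fun e => S (e 0)) ->
  exists cs n, [/\ 3 <= n, all (qbound n) cs
    & forall a, S a <-> exists z, [/\ z 0 = 1, z 1 = a & all (qsat z) cs]].
Proof.
case=> p [q hS]; pose n0 := 3 + maxn (tbound p) (tbound q).
have [|cs1 [r1 [n1 [le1 lt1 b1 sat1 ex1]]]] := @flatten_term p n0; first by lia.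
have [|cs2 [r2 [n2 [le2 lt2 b2 sat2 ex2]]]] := @flatten_term q n1; first by lia.
(* The first constraint, z_2 = 2 z_2, forces z_2 = 0; the second equates the two sides. That z_0 = 1
   cannot be forced likewise: the zero assignment satisfies every constraint. *)
exists [:: (0, 2, 2, 2), (0, r1, r2, 2) & cs1 ++ cs2], n2; split; first by lia.
  rewrite /= all_cat b2 (@qbound_leq n1 n2) //; lia.
move=> a; rewrite (hS (fun=> a)); split.
  case=> f hf.
  pose z0 i := match i with 0 => 1 | 1 => a | 2 => 0 | j.+3 => f j end.
  have hz0 : zwf z0 by [].
  have [z1 [e1 h1]] := ex1 z0 hz0.
  have hz1 : zwf z1 by apply: zwf_eq e1 hz0; lia.
  have [z2 [e2 h2]] := ex2 z1 hz1.
  have hz2 : zwf z2 by apply: zwf_eq e2 hz1; lia.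
  have h12 : all (qsat z2) cs1.
    by apply: qsat_eq b1 h1 => i lti; rewrite e2.
  have e20 i : i < n0 -> z2 i = z0 i by move=> lti; rewrite e2 ?e1 //; lia.
  have E t : tbound t <= maxn (tbound p) (tbound q) -> zev z2 t = ev (fun=> a) f t.
    move=> le_t; apply: ev_eq => i lti; first by rewrite e20 //; lia.
    by rewrite e20 // /n0; lia.
  have [z20 z22] := hz2.
  exists z2; split=> //; first by rewrite e20 //; lia.
  rewrite /= all_cat h12 h2 z20 z22 !mul1n !addn0 eqxx /= andbT.
  by rewrite (sat1 _ hz2 h12) (sat2 _ hz2 h2) !E ?hf // leq_max leqnn ?orbT.
case=> z [z0 z1]; rewrite /= all_cat z0 !mul1n => /and4P[/eqP h2 /eqP hr h1 h2'].
have hz : zwf z by split=> //; lia.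
exists (fun i => z i.+3); move: hr; rewrite (sat1 _ hz h1) (sat2 _ hz h2') /zev z1.
by case: hz => _ ->; rewrite addn0.
Qed.

(** * Coding the solution of a quadratic system *)

Definition code (B n : nat) (z : nat -> nat) := \sum_(i < n) z i * B ^ (2 ^ i).

Lemma codeS B n z : code B n.+1 z = code B n z + z n * B ^ (2 ^ n).
Proof. by rewrite /code big_ord_recr. Qed.

Lemma code_lt B c n z : 0 < c -> c <= B -> (forall i, z i < c) -> code B n z < B ^ (2 ^ n).
Proof.
move=> c0 le_cB hz; elim: n => [|n IHn]; first by rewrite /code big_ord0; lia.
rewrite codeS expnS mul2n -addnn expnD.
have h : B <= B ^ 2 ^ n by rewrite -{1}[B]expn1 leq_pexp2l ?expn_gt0 //; lia.
by move: (hz n) IHn h; move: (B ^ 2 ^ n) (code B n z) (z n) => u v x; nia.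
Qed.

(* The last condition says that [b %% B ^ 2 ^ i.+1 < c * B ^ 2 ^ i]. *)
Definition digits_ok (B c n a b : nat) :=
  [/\ a.+1 < c, exists d, b = B ^ 4 * d + (B + a * B ^ 2)
    & forall i, 2 <= i < n ->
        exists d, B ^ 2 ^ i.+1 * d <= b < B ^ 2 ^ i.+1 * d + c * B ^ 2 ^ i].

(** Induction on n: as the code is below B^(2^n) and B^(2^(n+1)) is the square of B^(2^n), the
    condition for i = n says that m modulo B^(2^n) is below c. This residue is the next digit z_n,
    and the quotient is the new m. *)
Lemma digits_ok_code B c n a b : c <= B -> 2 <= n ->
  digits_ok B c n a b ->
  exists z m, [/\ z 0 = 1, z 1 = a, forall i, z i < c & b = code B n z + m * B ^ 2 ^ n].
Proof.
move=> le_cB; elim: n => // n IHn; rewrite ltnS leq_eqVlt => /predU1P[<-|le2] [lt_a hb hd].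
  case: hb => d ->.
  exists (fun i => match i with 0 => 1 | 1 => a | _ => 0 end), d.
  split=> //; first by move=> [|[|i]]; lia.
  by rewrite !codeS /code big_ord0 expn0 expn1 /=; lia.
have [//||z [m [z0 z1 hz eb]]] := IHn.
  by split=> // i /andP[le2i lti]; apply: hd; lia.
have [|d /andP[hd1 hd2]] := hd n; first by rewrite le2 ltnSn.
have lt_code := code_lt n (leq_trans (ltn0Sn _) (ltnW lt_a)) le_cB hz.
have eB : B ^ 2 ^ n.+1 = B ^ 2 ^ n * B ^ 2 ^ n by rewrite expnS mul2n -addnn expnD.
have [le_dm lt_mc] : B ^ 2 ^ n * d <= m /\ m - B ^ 2 ^ n * d < c.
  by rewrite eB in hd1 hd2; move: (B ^ 2 ^ n) lt_code eb hd1 hd2 => u *; split; nia.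
exists (fun i => if i == n then m - B ^ 2 ^ n * d else z i), d; split.
- by case: eqVneq => //; lia.
- by case: eqVneq => //; lia.
- by move=> i; case: eqP.
rewrite codeS eqxx eb eB.
have -> : code B n (fun i => if i == n then m - B ^ 2 ^ n * d else z i) = code B n z.
  by apply: eq_bigr => i _; rewrite ltn_eqF.
by move: (B ^ 2 ^ n) le_dm => u le_dm; nia.
Qed.

Lemma code_split B n j z : j <= n -> exists d, code B n z = code B j z + B ^ 2 ^ j * d.
Proof.
elim: n => [|n IHn]; first by rewrite leqn0 => /eqP ->; exists 0; rewrite muln0 addn0.
rewrite leq_eqVlt => /predU1P[->|]; first by exists 0; rewrite muln0 addn0.
rewrite ltnS => le_jn; have [d ed] := IHn le_jn.
exists (d + z n * B ^ (2 ^ n - 2 ^ j)); rewrite codeS ed mulnDr addnA; congr addn.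
by rewrite mulnCA -expnD subnKC // leq_pexp2l.
Qed.

Lemma code_digits_ok B c n a z : c <= B -> 2 <= n -> a.+1 < c ->
  z 0 = 1 -> z 1 = a -> (forall i, z i < c) -> digits_ok B c n a (code B n z).
Proof.
move=> le_cB le2 lt_ac z0 z1 hz; split=> // [|i /andP[le2i lti]].
  have [d ->] := code_split B z le2; exists d.
  by rewrite addnC !codeS /code big_ord0 z0 z1; lia.
have [d ->] := code_split B z lti; exists d; rewrite codeS.
have c0 : 0 < c by lia.
have := code_lt i c0 le_cB hz; have := hz i.
by move: (B ^ 2 ^ i) (B ^ 2 ^ i.+1 * d) => u v *; apply/andP; split; nia.
Qed.

(* Multiplying by [B ^ (G - K)] brings the digits at position [K] to position [G]. *)
Lemma sum_digit (I : Type) (r : seq I) (w E : I -> nat) B C G K :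
  K <= G -> (forall i, w i <= C) -> exists rho m,
    (\sum_(i <- r) w i * B ^ E i) * B ^ (G - K) =
      (\sum_(i <- r | E i == K) w i) * B ^ G + rho + m * B ^ G.+1 /\
    rho * B <= size r * C * B ^ G.
Proof.
move=> le_KG hw; elim: r => [|i r [rho [m [IH le_rho]]]].
  by exists 0, 0; rewrite !big_nil !mul0n.
rewrite !big_cons mulnDl IH -mulnA -expnD /=.
(* A term below position K joins rho, a term above it joins m. *)
case: ltngtP => h /=.
- exists (rho + w i * B ^ (E i + (G - K))), m; split; first by ring.
  rewrite mulnDl -mulnA -expnSr.
  have : B ^ (E i + (G - K)).+1 <= B ^ G.
    case: (posnP B) => [->|B0]; last by rewrite leq_pexp2l //; lia.
    by rewrite exp0n.
  by have := hw i; move: le_rho; move: (B ^ _.+1) (B ^ G) => u v; nia.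
- exists rho, (m + w i * B ^ (E i - K.+1)); split; last by move: (B ^ G) le_rho => u; nia.
  rewrite mulnDl -[w i * _ * _]mulnA -expnD.
  have -> : E i - K.+1 + G.+1 = E i + (G - K) by lia.
  by ring.
exists rho, m; split; last by move: (B ^ G) le_rho => u; nia.
have -> : E i + (G - K) = G by lia.
by ring.
Qed.

(** The larger exponent is determined: for a <= b, 2^b < 2^a + 2^b <= 2^(b + 1). *)
Lemma exp2_sidon i j k l : 2 ^ i + 2 ^ j = 2 ^ k + 2 ^ l ->
  (i = k /\ j = l) \/ (i = l /\ j = k).
Proof.
have key a b c d : a <= b -> c <= d -> 2 ^ a + 2 ^ b = 2 ^ c + 2 ^ d -> d <= b.
  move=> le_ab le_cd h; rewrite leqNgt; apply/negP => lt_bd.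
  have h1 : 2 ^ b.+1 <= 2 ^ d by rewrite leq_pexp2l.
  have h2 : 2 ^ a <= 2 ^ b by rewrite leq_pexp2l.
  have h3 : 0 < 2 ^ c by rewrite expn_gt0.
  by move: h1; rewrite expnS; lia.
have inj a b : 2 ^ a = 2 ^ b -> a = b by apply: expnI.
have main a b c d : a <= b -> c <= d -> 2 ^ a + 2 ^ b = 2 ^ c + 2 ^ d -> a = c /\ b = d.
  move=> le_ab le_cd h; have ebd : b = d.
    by apply/eqP; rewrite eqn_leq (key c d a b) // (key a b c d).
  by split=> //; apply: inj; rewrite -ebd in h; lia.
case: (leqP i j) => [le_ij|/ltnW le_ji]; case: (leqP k l) => [le_kl|/ltnW le_lk] h.
- by left; exact: main.
- by right; apply: main => //; rewrite h addnC.
- by right; have [|-> ->] := main j i k l le_ji le_kl; first by rewrite addnC.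
by left; have [|-> ->] := main j i l k le_ji le_lk; first by rewrite addnC h addnC.
Qed.

Lemma size_index_enum (T : finType) : size (index_enum T) = #|T|.
Proof. by rewrite -sum1_size -sum1_card. Qed.

(** Position 2^n is common to all comparisons. As 2^k < 2^n, the shift moves the arbitrary part of b
    beyond it. *)
Lemma code_digit B C n z m k : (forall i, z i <= C) -> k < n -> exists rho m',
  (code B n z + m * B ^ 2 ^ n) * B ^ (2 ^ n - 2 ^ k) =
    z k * B ^ 2 ^ n + rho + m' * B ^ (2 ^ n).+1 /\ rho * B <= n * C * B ^ 2 ^ n.
Proof.
move=> hz ltkn; have lt_exp : 2 ^ k < 2 ^ n by rewrite ltn_exp2l.
have [rho [m' [e le_rho]]] := sum_digit (index_enum 'I_n) (w := fun i => z i)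
  (fun i => 2 ^ i) B (ltnW lt_exp) (fun i => hz i).
exists rho, (m' + m * B ^ (2 ^ n - (2 ^ k).+1)).
split; last by rewrite size_index_enum card_ord in le_rho.
rewrite mulnDl e (big_pred1 (Ordinal ltkn)) => [|i]; last first.
  by rewrite eqn_exp2l // -val_eqE.
rewrite mulnDl -[m * _ * B ^ (2 ^ n).+1]mulnA -[m * _ * B ^ (2 ^ n - 2 ^ k)]mulnA -!expnD.
have -> : 2 ^ n - (2 ^ k).+1 + (2 ^ n).+1 = 2 ^ n + (2 ^ n - 2 ^ k) by lia.
by ring.
Qed.

Lemma code_sq_digit B C n z m i j : (forall i, z i <= C) -> i < n -> j < n ->
  exists rho m', (code B n z + m * B ^ 2 ^ n) ^ 2 * B ^ (2 ^ n - (2 ^ i + 2 ^ j)) =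
    (if i == j then 1 else 2) * (z i * z j) * B ^ 2 ^ n + rho + m' * B ^ (2 ^ n).+1 /\
  rho * B <= n * n * (C * C) * B ^ 2 ^ n.
Proof.
move=> hz ltin ltjn.
have le_exp : 2 ^ i + 2 ^ j <= 2 ^ n.
  case: n ltin ltjn => // n ltin ltjn; rewrite expnS mul2n -addnn.
  by rewrite leq_add ?leq_pexp2l.
have [rho [m' [e le_rho]]] := sum_digit (index_enum ('I_n * 'I_n)%type)
  (w := fun p => z p.1 * z p.2) (fun p => 2 ^ p.1 + 2 ^ p.2) B le_exp
  (fun p => leq_mul (hz p.1) (hz p.2)).
rewrite size_index_enum card_prod card_ord in le_rho.
have esq : code B n z * code B n z =
    \sum_(p <- index_enum ('I_n * 'I_n)%type) z p.1 * z p.2 * B ^ (2 ^ p.1 + 2 ^ p.2).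
  rewrite /code big_distrlr /= pair_bigA /=; apply: eq_bigr => p _.
  by rewrite expnD mulnACA.
have edig : \sum_(p <- index_enum ('I_n * 'I_n)%type | 2 ^ p.1 + 2 ^ p.2 == 2 ^ i + 2 ^ j)
    z p.1 * z p.2 = (if i == j then 1 else 2) * (z i * z j).
  pose pi := Ordinal ltin; pose pj := Ordinal ltjn.
  rewrite (eq_bigl (fun p => (p == (pi, pj)) || (p == (pj, pi)))) => [|[a b]]; last first.
    rewrite !xpair_eqE -!val_eqE /=; apply/eqP/idP => [/exp2_sidon[[-> ->]|[-> ->]]|].
    - by rewrite !eqxx.
    - by rewrite !eqxx orbT.
    by case/orP=> /andP[/eqP-> /eqP->] //; rewrite addnC.
  case: eqVneq => [eij|neij].
    have -> : pj = pi by apply: val_inj.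
    by rewrite (big_pred1 (pi, pi)) => [|p]; rewrite ?orbb //= mul1n eij.
  have npij : (pj, pi) != (pi, pj) by rewrite xpair_eqE -val_eqE /= eq_sym (negPf neij).
  rewrite (bigD1 (pi, pj)) ?eqxx //= (big_pred1 (pj, pi)) => [/=|p].
    by rewrite mul2n -addnn [z j * _]mulnC.
  by case: (eqVneq p (pi, pj)) => [->|_] /=; rewrite ?andbT // eq_sym (negPf npij).
(* Thanks to this factor B, the cross term of the square is a multiple of B^(2^n + 1). *)
have [x ex] : exists x, code B n z = x * B.
  apply/dvdnP; apply: dvdn_sum => a _; apply: dvdn_mull.
  by rewrite -{1}[B]expn1 dvdn_exp2l // expn_gt0.
have eB : B ^ 2 ^ n = B * B ^ (2 ^ n).-1 by rewrite -expnS prednK // expn_gt0.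
exists rho, (m' + m * (2 * x + m * B ^ (2 ^ n).-1) * B ^ (2 ^ n - (2 ^ i + 2 ^ j))).
split=> //; rewrite -edig -mulnn.
have -> : (code B n z + m * B ^ 2 ^ n) * (code B n z + m * B ^ 2 ^ n) =
    code B n z * code B n z + m * (2 * x + m * B ^ (2 ^ n).-1) * (B ^ (2 ^ n).+1).
  by rewrite ex [B ^ (2 ^ n).+1]expnS eB; ring.
rewrite mulnDl esq e; ring.
Qed.

(* Agreement of the digits u and v at position W: the difference of U and V is at distance
   less than W / 2 from a multiple of W * B; S only keeps the quotient nonnegative. *)
Lemma digit_cmp (B W u v rho rho' m m' S : nat) :
  8 * rho <= W -> 8 * rho' <= W -> 0 < W -> u < B -> v < B -> m' <= S ->
  let U := u * W + rho + m * (W * B) in let V := v * W + rho' + m' * (W * B) in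
  u = v <-> exists d, 2 * (U + S * (W * B)) < 2 * (W * B) * d + 2 * V + W /\
                      2 * (W * B) * d + 2 * V < 2 * (U + S * (W * B)) + W.
Proof.
move=> hr hr' W0 ltu ltv lem U V; split.
  move=> euv; exists (m + S - m').
  have -> : 2 * (W * B) * (m + S - m') + 2 * V =
      2 * (W * B) * (m + S) + 2 * (v * W + rho').
    rewrite /V; have -> : m + S = m + S - m' + m' by lia.
    by rewrite addnK; ring.
  by rewrite /U euv; split; lia.
case=> d [h1 h2].
(* The inequalities bound |2XW| by W plus the rests, hence below 2W, so X = 0. Then B divides u - v,
   and |u - v| < B. *)
pose X : int := (Posz u - Posz v + (Posz m + Posz S - Posz m' - Posz d) * Posz B)%R.
have hX : (2 * X * Posz W = 2 * Posz (U + S * (W * B))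
    - Posz (2 * (W * B) * d + 2 * V) - 2 * Posz rho + 2 * Posz rho')%R.
  by rewrite /X /U /V !PoszD !PoszM; ring.
have X0 : X = 0%R.
  have b1 : (2 * X * Posz W < 2 * Posz W)%R by lia.
  have b2 : (- 2 * Posz W < 2 * X * Posz W)%R by lia.
  by clear -b1 b2 W0; nia.
move: X0; rewrite /X; move: (_ + _ - _ - _)%R => q; clear -ltu ltv => X0.
have q0 : q = 0%R by nia.
by move: X0; rewrite q0; lia.
Qed.

(** The square of the code has n^2 terms with coefficients at most c^2, so the rest below position
    2^n is at most B^(2^n) / 32. The 32 is 8 * 2 * 2: [digit_cmp] asks for 8 rho' <= W, and on the
    linear side rho' is up to twice the sum of two such rests. *)
Definition radix (n c : nat) := 32 * n * n * c * c.

(** The linear side is doubled for i <> j, like the digit of b^2. The [4 * b] is the S of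
    [digit_cmp]: the quotient of V is at most twice the sum of two quotients, each at most b. *)
Definition quad_ok (B n b : nat) (q : quad) :=
  let: (i, j, k, l) := q in
  let W := B ^ 2 ^ n in
  let U := b ^ 2 * B ^ (2 ^ n - (2 ^ i + 2 ^ j)) in
  let V := (if i == j then 1 else 2) *
    (b * B ^ (2 ^ n - 2 ^ k) + b * B ^ (2 ^ n - 2 ^ l)) in
  exists d, 2 * (U + 4 * b * (W * B)) < 2 * (W * B) * d + 2 * V + W /\
            2 * (W * B) * d + 2 * V < 2 * (U + 4 * b * (W * B)) + W.

Lemma quad_okP n c z m q : (forall i, z i < c) -> qbound n q ->
  quad_ok (radix n c) n (code (radix n c) n z + m * radix n c ^ 2 ^ n) q <-> qsat z q.
Proof.
case: q => [[[i j] k] l] hz /and4P[lti ltj ltk ltl].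
set B := radix n c; set b := code B n z + _.
have c0 : 0 < c by apply: leq_ltn_trans (hz 0).
have hz' a : z a <= c by exact: ltnW.
have n0 : 0 < n by lia.
have leB : 32 * (n * n * (c * c)) <= B by rewrite /B /radix; lia.
have lecc : 32 * (c * c) <= B.
  by apply: leq_trans leB; rewrite leq_mul2l /= leq_pmull // muln_gt0 n0.
have lec : 32 * c <= B by apply: leq_trans lecc; rewrite leq_mul2l /= leq_pmull.
have lenc : 32 * (n * c) <= B.
  by apply: leq_trans leB; rewrite leq_mul2l /= -mulnACA leq_pmull // muln_gt0 n0.
have B0 : 0 < B by lia.
have W0 : 0 < B ^ 2 ^ n by rewrite expn_gt0 B0.
have small C rho : 32 * C <= B -> rho * B <= C * B ^ 2 ^ n -> 32 * rho <= B ^ 2 ^ n.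
  move=> leC h; rewrite -(leq_pmul2r B0).
  by move: (B ^ 2 ^ n) h => W h; nia.
have [r [p [eU hr]]] := code_sq_digit B m hz' lti ltj.
have [rk [pk [ek hrk]]] := code_digit B m hz' ltk.
have [rl [pl [el hrl]]] := code_digit B m hz' ltl.
have {}hr := small _ _ leB hr.
have {}hrk := small _ _ lenc hrk; have {}hrl := small _ _ lenc hrl.
have pb a ra pa : (b * B ^ (2 ^ n - 2 ^ a) = z a * B ^ 2 ^ n + ra + pa * B ^ (2 ^ n).+1) ->
    pa <= b.
  move=> e; rewrite -(@leq_pmul2r (B ^ (2 ^ n).+1)) ?expn_gt0 ?B0 //.
  apply: (@leq_trans (b * B ^ (2 ^ n - 2 ^ a))); first by rewrite e leq_addl.
  by rewrite leq_mul2l leq_pexp2l ?orbT //; lia.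
have lek := pb _ _ _ ek; have lel := pb _ _ _ el.
rewrite /quad_ok /qsat; set dl := if i == j then 1 else 2.
rewrite -/dl in eU; have dl2 : 0 < dl <= 2 by rewrite /dl; case: eqP.
rewrite eU ek el [B ^ (2 ^ n).+1]expnSr.
have -> : dl * (z k * B ^ 2 ^ n + rk + pk * (B ^ 2 ^ n * B) +
    (z l * B ^ 2 ^ n + rl + pl * (B ^ 2 ^ n * B))) =
    dl * (z k + z l) * B ^ 2 ^ n + dl * (rk + rl) + dl * (pk + pl) * (B ^ 2 ^ n * B) by ring.
have bnd : dl * (z i * z j) < B /\ dl * (z k + z l) < B.
  have h1 : z i * z j <= c * c by apply: leq_mul.
  by move: (hz k) (hz l) => h2 h3; split; nia.
have h8 : 8 * (dl * (rk + rl)) <= B ^ 2 ^ n.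
  apply: (@leq_trans (16 * (rk + rl))); last by lia.
  by rewrite mulnA leq_mul2r; lia.
rewrite -(digit_cmp p (m' := dl * (pk + pl)) (S := 4 * b) _ h8 W0 bnd.1 bnd.2 _).
- by split=> [/eqP|/eqP ->//]; rewrite eqn_pmul2l //; lia.
- by lia.
by clear -dl2 lek lel; nia.
Qed.

Lemma leq_radix n c : 0 < n -> 0 < c -> c <= radix n c.
Proof. by move=> n0 c0; rewrite /radix leq_pmull // !muln_gt0 n0 c0. Qed.

Lemma code_system n cs a : 3 <= n -> all (qbound n) cs ->
  (exists z, [/\ z 0 = 1, z 1 = a & all (qsat z) cs]) <->
  exists b c, digits_ok (radix n c) c n a b /\
    forall q, q \in cs -> quad_ok (radix n c) n b q.
Proof.
move=> n3 hcs; have hb := allP hcs; split.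
  case=> z [z0 z1 hz].
  (* The coding lemmas bound all digits by c, whereas z is arbitrary from n on. *)
  pose z' i := if i < n then z i else 0.
  pose c := (a.+1 + \max_(i < n) z i).+1; pose B := radix n c.
  have hc i : z' i < c.
    rewrite /z'; case: ifP => // lti; rewrite ltnS; apply: leq_trans (leq_addl _ _).
    exact: (leq_bigmax (F := fun i : 'I_n => z i) (Ordinal lti)).
  have le_cB : c <= B by apply: leq_radix => //; lia.
  exists (code B n z'), c; split.
    by apply: code_digits_ok => //; rewrite /z' /c ?ifT //; lia.
  move=> q hq; have := quad_okP 0 hc (hb q hq); rewrite -/B mul0n addn0 => ->.
  have : all (qsat z') cs.
    by apply: (qsat_eq (n := n) _ hcs hz) => i lti; rewrite /z' lti.
  by move/allP; apply.
case=> b [c [hd hq]]; have [lt_ac _ _] := hd.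
have [||z [m [z0 z1 hz eb]]] := digits_ok_code _ _ hd; try lia.
  by apply: leq_radix; lia.
exists z; split=> //; apply/allP => q in_q.
by apply/(quad_okP m hz (hb q in_q)); rewrite -eb; exact: hq.
Qed.

(** * Interval conditions *)

Section Polynomials.
Local Open Scope ring_scope.
Implicit Types (p q : {mpoly int[3]}) (a b c : nat).

Lemma Posz_exp m n : Posz (m ^ n) = Posz m ^+ n.
Proof. by elim: n => // n IHn; rewrite expnS exprS PoszM IHn. Qed.

Lemma eval3D p q a b c : eval3 (p + q) a b c = eval3 p a b c + eval3 q a b c.
Proof. exact: mevalD. Qed.

Lemma eval3N p a b c : eval3 (- p) a b c = - eval3 p a b c.
Proof. exact: mevalN. Qed.

Lemma eval3M p q a b c : eval3 (p * q) a b c = eval3 p a b c * eval3 q a b c.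
Proof. exact: mevalM. Qed.

Lemma eval3Xn p n a b c : eval3 (p ^+ n) a b c = eval3 p a b c ^+ n.
Proof. by rewrite /eval3 rmorphXn. Qed.

Lemma eval3_nat n a b c : eval3 n%:R a b c = Posz n.
Proof. by rewrite /eval3 rmorph_nat natz. Qed.

Lemma eval3_var (i : 'I_3) a b c :
  eval3 'X_i a b c = tnth [tuple Posz a; Posz b; Posz c] i.
Proof. exact: mevalXU. Qed.

Let pa : {mpoly int[3]} := 'X_(@Ordinal 3 0 isT).
Let pb : {mpoly int[3]} := 'X_(@Ordinal 3 1 isT).
Let pc : {mpoly int[3]} := 'X_(@Ordinal 3 2 isT).
Definition pradix n : {mpoly int[3]} := 32%:R * n%:R * n%:R * pc * pc.

Lemma eval3_pa a b c : eval3 pa a b c = Posz a.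
Proof. by rewrite eval3_var. Qed.

Lemma eval3_pb a b c : eval3 pb a b c = Posz b.
Proof. by rewrite eval3_var. Qed.

Lemma eval3_pc a b c : eval3 pc a b c = Posz c.
Proof. by rewrite eval3_var. Qed.

Lemma eval3_pradix n a b c : eval3 (pradix n) a b c = Posz (radix n c).
Proof. by rewrite !eval3M !eval3_nat eval3_pc. Qed.

Definition eval3E := (eval3D, eval3N, eval3M, eval3Xn, eval3_nat, eval3_pa, eval3_pb,
  eval3_pc, eval3_pradix).

Definition triple : Type := {mpoly int[3]} * {mpoly int[3]} * {mpoly int[3]}.

Definition tsat (t : triple) a b c := exists d : nat,
  eval3 t.1.1 a b c < eval3 t.1.2 a b c * Posz d < eval3 t.2 a b c.

Definition bound_triple : triple := (pa + 1%:R, 1%:R, pc + 1%:R).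

(** The only integer strictly between r - 1 and r + 1 is r, so this interval expresses an
    equation. *)
Definition start_triple n : triple :=
  let r := pb - (pradix n + pa * pradix n ^+ 2) in (r - 1%:R, pradix n ^+ 4, r + 1%:R).

Definition digit_triple n i : triple :=
  (pb - pc * pradix n ^+ (2 ^ i), pradix n ^+ (2 ^ i.+1), pb + 1%:R).

Definition quad_triple n (q : quad) : triple :=
  let: (i, j, k, l) := q in
  let W := pradix n ^+ (2 ^ n) in
  let U := pb ^+ 2 * pradix n ^+ (2 ^ n - (2 ^ i + 2 ^ j)) in
  let V := (if i == j then 1 else 2)%:R *
    (pb * pradix n ^+ (2 ^ n - 2 ^ k) + pb * pradix n ^+ (2 ^ n - 2 ^ l)) in
  let T := 2%:R * (U + 4%:R * pb * (W * pradix n) - V) in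
  (T - W, 2%:R * (W * pradix n), T + W).

Lemma bound_tripleP a b c : tsat bound_triple a b c <-> (a.+1 < c)%N.
Proof.
rewrite /tsat /= !eval3E; split=> [[d]|h]; first by lia.
by exists c; lia.
Qed.

Lemma start_tripleP n a b c : let B := radix n c in
  tsat (start_triple n) a b c <-> exists d, b = (B ^ 4 * d + (B + a * B ^ 2))%N.
Proof.
rewrite /tsat /= !eval3E -!Posz_exp; move: (radix n c) (radix n c ^ 2)%N (radix n c ^ 4)%N.
move=> B B2 B4; split=> -[d h]; exists d; lia.
Qed.

Lemma digit_tripleP n i a b c : let B := radix n c in
  tsat (digit_triple n i) a b c <->
  exists d, (B ^ 2 ^ i.+1 * d <= b < B ^ 2 ^ i.+1 * d + c * B ^ 2 ^ i)%N.
Proof.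
rewrite /tsat /= !eval3E -!Posz_exp; move: (radix n c ^ 2 ^ i)%N (radix n c ^ 2 ^ i.+1)%N.
by move=> B1 B2; split=> -[d h]; exists d; lia.
Qed.

Lemma quad_tripleP n (q : quad) a b c :
  tsat (quad_triple n q) a b c <-> quad_ok (radix n c) n b q.
Proof.
case: q => [[[i j] k] l]; rewrite /tsat /quad_ok /= !eval3E -!Posz_exp.
move: (radix n c) (radix n c ^ 2 ^ n)%N (b ^ 2)%N (if i == j then 1%N else 2%N) => B W b2 dl.
move: (B ^ _)%N (B ^ _)%N (B ^ _)%N => u v w.
split=> -[d h]; exists d; lia.
Qed.

End Polynomials.

Local Open Scope ring_scope.

Theorem theorem1 (A : nat -> Prop) (hA : recursively_enumerable A) :
  exists (eps : nat) (P D Q : 'I_eps -> {mpoly int[3]}),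
    (0 < eps)%N /\
    forall a : nat,
      A a <->
      exists b c : nat, forall i : 'I_eps, exists d : nat,
        eval3 (P i) a b c < eval3 (D i) a b c * d%:Z < eval3 (Q i) a b c.
Proof.
have [f hf] := hA.
pose S a := exists y, computes f [tuple a] y.
have dioS : dio (fun e => S (e 0%N)).
  apply: dio_ex; cbv beta; apply: dio_computes; first exact: dio_parrec.
    by case=> [|[|i]] /=; [exact: dfun_proj | exact: dfun_const | exact: dfun_const].
  exact: dfun_proj.
have [cs [n [n3 hb hA']]] := flatten_dio dioS.
(* The digit conditions start at 2, since [start_triple] fixes digits 0 and 1. The list depends on n
   and [cs] only, not on a. *)
pose ts := [:: bound_triple, start_triple n
  & [seq digit_triple n i | i <- iota 2 (n - 2)] ++ [seq quad_triple n q | q <- cs]].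
exists (size ts).
exists (fun i => (nth bound_triple ts i).1.1), (fun i => (nth bound_triple ts i).1.2).
exists (fun i => (nth bound_triple ts i).2); split=> // a.
rewrite hf -/(S a) hA' (code_system a n3 hb).
suff key b c : (digits_ok (radix n c) c n a b /\
    forall q, q \in cs -> quad_ok (radix n c) n b q) <->
    forall i : 'I_(size ts), tsat (nth bound_triple ts i) a b c.
  by split=> -[b [c h]]; exists b, c; apply/key.
split.
  case=> -[h1 h2 h3] hq i.
  have : nth bound_triple ts i \in ts by apply: mem_nth.
  rewrite !in_cons mem_cat => /or4P[/eqP->|/eqP->|/mapP[j]|/mapP[q hq' ->]].
  - exact/bound_tripleP.
  - exact/start_tripleP.
  - by rewrite mem_iota => hj ->; apply/digit_tripleP/h3; lia.
  - by apply/quad_tripleP; exact: hq.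
move=> h.
have ht t : t \in ts -> tsat t a b c.
  by case/(nthP bound_triple)=> i lti <-; exact: (h (Ordinal lti)).
have ts_sub t : t \in behead (behead ts) -> t \in ts by move=> ht'; do 2!apply: mem_behead.
split; first split.
- by apply/(@bound_tripleP a b c)/ht; rewrite in_cons eqxx.
- by apply/start_tripleP/ht; rewrite !in_cons eqxx orbT.
- move=> i hi; apply/(@digit_tripleP n i a b c)/ht.
  by apply: ts_sub; rewrite mem_cat map_f // mem_iota; lia.
move=> q hq; apply/(@quad_tripleP n q a b c)/ht.
by apply: ts_sub; rewrite mem_cat orbC map_f.
Qed.
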